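(* Let $0<\alpha<1$ and $1\le i\le k\le 6$. With $\omega^{(k,i)}(\xi)=\sum_{m\ge0}\omega^{(k,i)}_m\xi^m$ (which converges absolutely for $|\xi|\le1$) and the stability region $S^{(k,i)}$ defined in the context, $$S^{(k,i)}=\mathbb{C}\setminus\{\omega^{(k,i)}(\xi):\ |\xi|\le 1\}.$$
   Context: Uniform grid $t_n=n\Delta t$, $\Delta t>0$, $I_j=[t_{j-1},t_j]$. For a function $u$ and integers $m\ge1$, $j$, $q$, let $p^{m}_{j,q}$ be the polynomial of degree at most $m$ interpolating $u$ at $t_{j+q-m-1},\dots,t_{j+q-1}$. For $1\le i\le k\le 6$ and $n\ge k$, let $P^{k}_{i,n}$ be the continuous piecewise polynomial on $[0,t_n]$ equal on $I_j$ to $p^{k-1}_{j,k-j}$ for $1\le j\le k-i$, to $p^{k}_{j,i}$ for $k-i+1\le j\le n-i+1$, and to $p^{k}_{j,n+1-j}$ for $n-i+2\le j\le n$, and set $D^{\alpha}_{k,i}u_n=\frac{1}{\Gamma(1-\alpha)}\int_0^{t_n}(t_n-\xi)^{-\alpha}(P^{k}_{i,n})'(\xi)\,\mathrm{d}\xi$. This is a linear combination of $u_0,\dots,u_n$ ($u_j=u(t_j)$); for $k\le j\le n$ the coefficient of $u_j$ in $(\Delta t)^{\alpha}D^{\alpha}_{k,i}u_n$ depends only on $n-j$ and is denoted $\omega^{(k,i)}_{n-j}$ (defining $\omega^{(k,i)}_m$ for all $m\ge0$), and $w^{(k,i)}_{n,j}$ ($0\le j\le k-1$) are defined by $(\Delta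 t)^{\alpha}D^{\alpha}_{k,i}u_n=\sum_{j=0}^{k-1}w^{(k,i)}_{n,j}u_j+\sum_{j=0}^{n}\omega^{(k,i)}_{n-j}u_j$. Applying the method to ${}^{C}D^{\alpha}u=\lambda u$ gives, with $z=\lambda(\Delta t)^{\alpha}$, the recursion $\sum_{j=0}^{k-1}w^{(k,i)}_{n,j}u_j+\sum_{j=0}^{n}\omega^{(k,i)}_{n-j}u_j=z u_n$, $n\ge k$. The stability region $S^{(k,i)}$ is the set of $z\in\mathbb{C}$ such that for every choice of bounded starting values $u_0,\dots,u_{k-1}\in\mathbb{C}$ this recursion determines $(u_n)_{n\ge k}$ and $u_n\to0$ as $n\to\infty$. *)

(* Defs.v *)
From Stdlib Require Import Reals Lra Lia.
From Coquelicot Require Import Coquelicot.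
Open Scope R_scope.

Definition Gamma (s : R) : R :=
  RInt_gen (fun t => Rpower t (s - 1) * exp (- t)) (at_right 0) (Rbar_locally p_infty).

Definition node (dt : R) (j : nat) : R := INR j * dt.

Definition lagr (dt : R) (v : nat -> R) (m s : nat) (x : R) : R :=
  sum_f_R0 (fun l => v (s + l)%nat *
     prod_f_R0 (fun r => if Nat.eqb r l then 1
                         else (x - node dt (s + r)) / (node dt (s + l) - node dt (s + r))) m) m.

(* p^m_{j,q}: interpolates at t_(j+q-m-1), ..., t_(j+q-1)
   (the start index j+q-m-1 is always >= 0 where it is used). *)
Definition interp (dt : R) (v : nat -> R) (m j q : nat) : R -> R :=
  lagr dt v m ((j + q) - (m + 1))%nat.

Definition piece (dt : R) (v : nat -> R) (k i n j : nat) : R -> R :=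
  if (j <=? k - i)%nat then interp dt v (k - 1) j (k - j)
  else if (j <=? n + 1 - i)%nat then interp dt v k j i
  else interp dt v k j (n + 1 - j).

(* P^k_{i,n}: on [0,t_n], x lies in I_j with j = min(n, floor(x/dt)+1)
   (at interior nodes both adjacent pieces agree by continuity). *)
Definition Pk (dt : R) (v : nat -> R) (k i n : nat) (x : R) : R :=
  piece dt v k i n (Nat.min n (Z.to_nat (up (x / dt)))) x.

Definition Dalpha (dt alpha : R) (k i : nat) (v : nat -> R) (n : nat) : R :=
  / Gamma (1 - alpha) *
  RInt_gen (fun xi => Rpower (node dt n - xi) (- alpha) * Derive (Pk dt v k i n) xi)
           (at_point 0) (at_left (node dt n)).

(* coefficient of u_j in (dt)^alpha D^alpha_{k,i} u_n (the operator is linear in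
   the grid values, so this is its value on the unit grid function at j) *)
Definition coef (dt alpha : R) (k i n j : nat) : R :=
  Rpower dt alpha * Dalpha dt alpha k i (fun m => if Nat.eqb m j then 1 else 0) n.

Definition omega (dt alpha : R) (k i m : nat) : R := coef dt alpha k i (m + k) k.

Definition wcoef (dt alpha : R) (k i n j : nat) : R :=
  coef dt alpha k i n j - omega dt alpha k i (n - j).

(* the recursion for ^C D^alpha u = lambda u with z = lambda dt^alpha *)
Definition recursion (dt alpha : R) (k i : nat) (z : C) (u : nat -> C) : Prop :=
  forall n : nat, (k <= n)%nat ->
    (sum_n (fun j => RtoC (wcoef dt alpha k i n j) * u j) (k - 1)
     + sum_n (fun j => RtoC (omega dt alpha k i (n - j)) * u j) n)%C = (z * u n)%C.

Definition starts (k : nat) (u s : nat -> C) : Prop :=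
  forall j : nat, (j < k)%nat -> u j = s j.

Definition stab_region (dt alpha : R) (k i : nat) (z : C) : Prop :=
  forall s : nat -> C,
    (exists u, starts k u s /\ recursion dt alpha k i z u) /\
    (forall u v, starts k u s -> starts k v s ->
       recursion dt alpha k i z u -> recursion dt alpha k i z v ->
       forall n, u n = v n) /\
    (forall u, starts k u s -> recursion dt alpha k i z u ->
       is_lim_seq (fun n => Cmod (u n)) 0).

(* Main.v *)
(* Write [f = omega - z] for the symbol, as an element of the convolution algebra of sequences.
   A solution of the recursion satisfies [f * u = g], where [g n] is, for [n >= k], a combination
   of the starting weights [w n j] and hence tends to [0].  If [f] has no zero in the closed disc,
   Wiener's lemma makes the formal inverse [c] of [f] absolutely summable, so [u = c * g] tends
   to [0].  The lemma is proved in Newman's style: [f] is close in the l1 norm to a polynomial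
   whose inverse has powers controlled by the Cauchy estimate on a slightly larger disc.

   Conversely let [z = omega(xi)] with [|xi| <= 1].  Constants are annihilated by the method, which
   makes [0] unstable (take [u = 1]), gives [omega(1) = 0], and shows that with starting values [1]
   the differences [y] of a solution satisfy [f * y = f + z delta_k].  If [u] tends to [0], then so
   do the partial sums of [(f * y) xi^n] when [xi <> 1], because the partial sums of [f xi^n] are
   summable (summation by parts, [omega] having summable variation tails).  Evaluating at [xi]
   gives [z xi^k = 0], which leaves only the degenerate point [xi = 0].

   Summability of [omega] comes from [omega m] being the integral of the kernel against a fixed
   compactly supported function of mean zero. *)
Require Import Defs.
From Stdlib Require Import Reals Lra Lia ZArith.
From Stdlib Require Import FunctionalExtensionality ClassicalEpsilon Classical.
From Coquelicot Require Import Coquelicot.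
Open Scope R_scope.

(** * The convolution ring of complex sequences *)

(** The formal inverse of [f] exists as soon as [f 0] is nonzero; the difficulty is its size,
    because the Cauchy estimate presupposes the very summability to be proved. Two devices break the
    circle. The estimate uses summability only qualitatively, and boundedness at one radius gives
    summability at every smaller one. And since [f] need not extend beyond the disc, the last step
    inverts a polynomial, which does. Coefficients are recovered by averaging over roots of unity,
    without complex integration.

    For instability, differences are taken because on the unit circle the forcing
    [z (X^k + X^(k+1) + ...)] has no value at [xi], while multiplication by [1 - X] reduces it to a
    monomial. The bound found for [omega m] is of order [m^(-1-alpha)], so absolute tails are
    controlled only by [n^(-alpha)], which is not summable; the oscillation of [xi^n] for [xi <> 1]
    recovers the lost power. *)

Definition tl (a : nat -> C) : nat -> C := fun n => a (S n).

(** The recursion peels off the constant term of the left factor, [a = a 0 + X (tl a)], so that the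
    ring laws are inductions generalised over [a]. The closed sum is [conv_sum_n]. *)
Fixpoint conv (a b : nat -> C) (n : nat) : C :=
  match n with
  | O => (a O * b O)%C
  | S p => (a O * b (S p) + conv (tl a) b p)%C
  end.

Definition szero : nat -> C := fun _ => RtoC 0.
Definition sone : nat -> C := fun n => match n with O => RtoC 1 | S _ => RtoC 0 end.
Definition sadd (a b : nat -> C) : nat -> C := fun n => (a n + b n)%C.
Definition sopp (a : nat -> C) : nat -> C := fun n => (- a n)%C.
Definition ssub (a b : nat -> C) : nat -> C := fun n => (a n - b n)%C.
(** As a power series this is [1 / (1 - X)]: convolution with it takes partial sums, which turns
    summation arguments into ring identities. *)
Definition ones : nat -> C := fun _ => RtoC 1.
(** Substitution of [x X] for [X], a ring endomorphism; the value of the series [a] at [x] is the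
    sum of [wt x a]. *)
Definition wt (x : C) (a : nat -> C) : nat -> C := fun n => (a n * x ^ n)%C.

(** Additivity and homogeneity are joined because [tl (conv a b)] has exactly the form
    [a 0 * tl b + conv (tl a) b]; associativity then needs a single rewriting. *)
Lemma conv_axpy_l (x : C) (a b c : nat -> C) (n : nat) :
  conv (fun m => x * a m + b m)%C c n = (x * conv a c n + conv b c n)%C.
Proof.
  revert a b. induction n as [|n IH]; intros a b; simpl.
  - ring.
  - change (tl (fun m => (x * a m + b m)%C)) with (fun m => (x * tl a m + tl b m)%C).
    rewrite IH. ring.
Qed.

Lemma conv_S_r (a b : nat -> C) (n : nat) :
  conv a b (S n) = (a (S n) * b O + conv a (tl b) n)%C.
Proof.
  revert a. induction n as [|n IH]; intros a.
  - simpl. unfold tl. ring.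
  - change (conv a b (S (S n))) with (a O * b (S (S n)) + conv (tl a) b (S n))%C.
    rewrite IH. simpl. unfold tl. ring.
Qed.

Lemma conv_comm (a b : nat -> C) : conv a b = conv b a.
Proof.
  apply functional_extensionality; intros n. revert a.
  induction n as [|n IH]; intros a.
  - simpl. ring.
  - rewrite (conv_S_r b a). simpl. rewrite IH. ring.
Qed.

Lemma conv_assoc (a b c : nat -> C) : conv a (conv b c) = conv (conv a b) c.
Proof.
  apply functional_extensionality; intros n. revert a.
  induction n as [|n IH]; intros a.
  - simpl. ring.
  - simpl. rewrite IH.
    change (tl (conv a b)) with (fun m => a O * tl b m + conv (tl a) b m)%C.
    rewrite conv_axpy_l. ring.
Qed.

Lemma conv_one_l (a : nat -> C) : conv sone a = a.
Proof.
  apply functional_extensionality; intros [|n]; simpl; [ring|].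
  assert (H : conv (tl sone) a n = RtoC 0).
  { generalize n; clear n. change (tl sone) with szero.
    induction n as [|n IH]; simpl; [unfold szero; ring|].
    change (tl szero) with szero. rewrite IH. unfold szero. ring. }
  rewrite H. ring.
Qed.

Lemma seq_ring : ring_theory szero sone sadd conv ssub sopp eq.
Proof.
  constructor; intros; try (apply functional_extensionality; intros p;
    unfold sadd, szero, sopp, ssub; ring).
  - apply conv_one_l.
  - apply conv_comm.
  - apply conv_assoc.
  - apply functional_extensionality; intros p.
    replace (sadd x y) with (fun m => RtoC 1 * x m + y m)%C
      by (apply functional_extensionality; intros; unfold sadd; ring).
    rewrite conv_axpy_l. unfold sadd. ring.
Qed.

Add Ring seq_ring_inst : seq_ring.

Fixpoint spow (a : nat -> C) (n : nat) : nat -> C :=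
  match n with O => sone | S p => conv a (spow a p) end.

Lemma spow_conv (a b : nat -> C) (n : nat) :
  spow (conv a b) n = conv (spow a n) (spow b n).
Proof. induction n as [|n IH]; simpl; [ring | rewrite IH; ring]. Qed.

Lemma conv_sum_n (a b : nat -> C) (n : nat) :
  conv a b n = sum_n (fun j => a j * b (n - j)%nat)%C n.
Proof.
  revert b. induction n as [|n IH]; intros b.
  - rewrite sum_O. reflexivity.
  - rewrite conv_S_r, sum_Sn, Nat.sub_diag, IH.
    rewrite (sum_n_ext_loc _ (fun j => a j * b (S n - j)%nat)%C).
    + apply Cplus_comm.
    + intros p Hp. unfold tl. do 2 f_equal. lia.
Qed.

Lemma conv_ones_r (a : nat -> C) (n : nat) : conv a ones n = sum_n a n.
Proof.
  rewrite conv_sum_n. apply sum_n_ext. intros p. apply Cmult_1_r.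
Qed.


Lemma conv_scal_l (x : C) (a b : nat -> C) (n : nat) :
  conv (fun m => x * a m)%C b n = (x * conv a b n)%C.
Proof.
  replace (fun m => x * a m)%C with (fun m => x * a m + szero m)%C.
  - rewrite conv_axpy_l. replace (conv szero b) with szero by ring.
    unfold szero; ring.
  - apply functional_extensionality; intros; unfold szero; ring.
Qed.

Lemma wt_conv (x : C) (a b : nat -> C) : wt x (conv a b) = conv (wt x a) (wt x b).
Proof.
  apply functional_extensionality; intros n. unfold wt at 1. revert a.
  induction n as [|n IH]; intros a; simpl.
  - unfold wt. simpl. ring.
  - replace (tl (wt x a)) with (fun m => x * wt x (tl a) m)%C
      by (apply functional_extensionality; intros; unfold tl, wt; simpl; ring).
    rewrite conv_scal_l, <- IH. unfold wt. simpl. ring.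
Qed.

Lemma wt_one (x : C) : wt x sone = sone.
Proof. apply functional_extensionality; intros [|n]; unfold wt; simpl; ring. Qed.

Lemma wt_wt (x y : C) (a : nat -> C) : wt x (wt y a) = wt (x * y)%C a.
Proof.
  apply functional_extensionality; intros n. unfold wt. rewrite Cpow_mult_l. ring.
Qed.

Lemma wt_spow (x : C) (a : nat -> C) (n : nat) : wt x (spow a n) = spow (wt x a) n.
Proof. induction n as [|n IH]; simpl; [apply wt_one | rewrite wt_conv, IH; reflexivity]. Qed.

(** * Summable and null sequences under convolution *)

Definition asum (a : nat -> C) (n : nat) : R := sum_f_R0 (fun m => Cmod (a m)) n.
Definition l1b (a : nat -> C) (K : R) : Prop := forall n, asum a n <= K.
Definition limC (x : nat -> C) (l : C) : Prop :=
  forall eps, 0 < eps -> exists N, forall n, (N <= n)%nat -> Cmod (x n - l)%C < eps.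

Lemma asum_S (a : nat -> C) (n : nat) : asum a (S n) = Cmod (a O) + asum (tl a) n.
Proof.
  unfold asum. rewrite decomp_sum by lia. simpl pred. reflexivity.
Qed.

Lemma asum_pos (a : nat -> C) (n : nat) : 0 <= asum a n.
Proof. apply cond_pos_sum. intros; apply Cmod_ge_0. Qed.

Lemma asum_le (a b : nat -> C) (n : nat) :
  (forall m, Cmod (a m) <= Cmod (b m)) -> asum a n <= asum b n.
Proof. intros H. apply sum_Rle. intros; apply H. Qed.

Lemma asum_add (a b : nat -> C) (n : nat) : asum (sadd a b) n <= asum a n + asum b n.
Proof.
  unfold asum. rewrite <- sum_plus. apply sum_Rle. intros; apply Cmod_triangle.
Qed.

Lemma asum_mono (a : nat -> C) (n m : nat) : (n <= m)%nat -> asum a n <= asum a m.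
Proof.
  induction 1 as [|m H IH]; [lra|]. unfold asum in *. simpl.
  pose proof (Cmod_ge_0 (a (S m))). lra.
Qed.

Lemma term_le_asum (a : nat -> C) (n : nat) : Cmod (a n) <= asum a n.
Proof.
  destruct n; unfold asum; simpl; [lra|].
  pose proof (asum_pos a n). unfold asum in *. lra.
Qed.

Lemma l1b_pos (a : nat -> C) (K : R) : l1b a K -> 0 <= K.
Proof. intros H. eapply Rle_trans; [apply (asum_pos a 0) | apply H]. Qed.

Lemma conv_sup_le (a b : nat -> C) (B : R) (n : nat) :
  (forall m, Cmod (b m) <= B) -> Cmod (conv a b n) <= asum a n * B.
Proof.
  intros Hb. revert a. induction n as [|n IH]; intros a.
  - simpl. unfold asum; simpl. rewrite Cmod_mult.
    apply Rmult_le_compat_l; [apply Cmod_ge_0 | apply Hb].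
  - rewrite asum_S. simpl. eapply Rle_trans; [apply Cmod_triangle|].
    rewrite Cmod_mult, Rmult_plus_distr_r. apply Rplus_le_compat; [|apply IH].
    apply Rmult_le_compat_l; [apply Cmod_ge_0 | apply Hb].
Qed.

Lemma asum_conv_le (a b : nat -> C) (B : R) (n : nat) :
  l1b b B -> asum (conv a b) n <= asum a n * B.
Proof.
  intros Hb. revert a. induction n as [|n IH]; intros a.
  - unfold asum; simpl. rewrite Cmod_mult.
    apply Rmult_le_compat_l; [apply Cmod_ge_0 | apply (Hb O)].
  - rewrite !asum_S.
    replace (tl (conv a b)) with (sadd (fun m => a O * tl b m)%C (conv (tl a) b))
      by (apply functional_extensionality; reflexivity).
    assert (H1 : asum (fun m => a O * tl b m)%C n = Cmod (a O) * asum (tl b) n).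
    { unfold asum. rewrite scal_sum. apply sum_eq. intros; rewrite Cmod_mult; ring. }
    pose proof (asum_add (fun m => a O * tl b m)%C (conv (tl a) b) n) as H2.
    pose proof (IH (tl a)) as H3. pose proof (Hb (S n)) as H4. rewrite asum_S in H4.
    simpl. rewrite Cmod_mult. pose proof (Cmod_ge_0 (a O)). nra.
Qed.

Lemma l1b_conv (a b : nat -> C) (A B : R) : l1b a A -> l1b b B -> l1b (conv a b) (A * B).
Proof.
  intros Ha Hb n. eapply Rle_trans; [apply asum_conv_le, Hb|].
  apply Rmult_le_compat_r; [eapply l1b_pos, Hb | apply Ha].
Qed.

Lemma l1b_one : l1b sone 1.
Proof.
  intros n. assert (H : asum sone n = 1); [|lra].
  induction n as [|n IH]; unfold asum in *; simpl in *; rewrite ?Cmod_1, ?Cmod_0 in *; lra.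
Qed.

Lemma l1b_spow (a : nat -> C) (A : R) (n : nat) : l1b a A -> l1b (spow a n) (A ^ n).
Proof.
  intros H. induction n as [|n IH]; simpl; [apply l1b_one | apply l1b_conv; assumption].
Qed.

Lemma l1b_tail (a : nat -> C) (A eps : R) : l1b a A -> 0 < eps ->
  exists N, forall n, asum (fun m => a (N + m)%nat) n <= eps.
Proof.
  intros Ha Heps.
  assert (Hc : ex_finite_lim_seq (asum a)).
  { apply ex_finite_lim_seq_incr with A; [|exact Ha].
    intros n. apply asum_mono. lia. }
  destruct Hc as [l Hl]. apply is_lim_seq_spec in Hl.
  destruct (Hl (mkposreal _ (Rlt_gt _ _ (is_pos_div_2 (mkposreal eps Heps))))) as [N HN].
  simpl in HN. exists (S N). intros n.
  assert (E : asum a (S N + n) = asum a N + asum (fun m => a (S N + m)%nat) n).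
  { unfold asum. rewrite (tech2 _ N (S N + n)) by lia.
    f_equal. f_equal. lia. }
  pose proof (HN N (Nat.le_refl _)) as H1. pose proof (HN (S N + n)%nat ltac:(lia)) as H2.
  apply Rabs_def2 in H1. apply Rabs_def2 in H2. lra.
Qed.

Lemma limC_bounded (x : nat -> C) (l : C) : limC x l -> exists B, forall n, Cmod (x n) <= B.
Proof.
  intros H. destruct (H 1 Rlt_0_1) as [N HN].
  exists (asum x N + (Cmod l + 1)). intros n.
  pose proof (asum_pos x N). pose proof (Cmod_ge_0 l).
  destruct (le_lt_dec n N) as [h|h].
  - pose proof (term_le_asum x n). pose proof (asum_mono x n N h). lra.
  - pose proof (HN n ltac:(lia)) as Hn.
    replace (x n) with (l + (x n - l))%C by ring.
    pose proof (Cmod_triangle l (x n - l)%C). lra.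
Qed.

(** In the convolution at [N + n], a coefficient [a j] with [j < N] meets an entry of [x] of index
    beyond [n], which is small; the remaining coefficients form the tail of [a] and meet bounded
    entries. *)
Lemma conv_split (a x : nat -> C) (B e : R) (N n : nat) :
  (forall m, (n < m)%nat -> Cmod (x m) <= e) ->
  (forall m, Cmod (x m) <= B) ->
  Cmod (conv a x (N + n)) <= asum a (N + n) * e + asum (fun m => a (N + m)%nat) n * B.
Proof.
  intros He HB. assert (e0 : 0 <= e).
  { eapply Rle_trans; [apply Cmod_ge_0 | apply (He (S n)); lia]. }
  revert a. induction N as [|N IH]; intros a.
  - simpl. pose proof (conv_sup_le a x B n HB) as H. pose proof (asum_pos a n).
    change (fun m => a m) with a. nra.
  - simpl Nat.add. rewrite asum_S. simpl conv.
    eapply Rle_trans; [apply Cmod_triangle|].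
    pose proof (IH (tl a)) as H. unfold tl at 3 in H. rewrite Cmod_mult.
    pose proof (He (S (N + n)) ltac:(lia)). pose proof (Cmod_ge_0 (a O)).
    change (fun m => a (S N + m)%nat) with (fun m => a (S (N + m))) in *. nra.
Qed.

(** Both halves of the theorem end here: stability with [a] the summable inverse, instability with
    [a] the summable sequence of partial sums of the symbol. *)
Lemma conv_lim_0 (a x : nat -> C) (A : R) : l1b a A -> limC x 0 -> limC (conv a x) 0.
Proof.
  intros Ha Hx eps Heps.
  destruct (limC_bounded x 0 Hx) as [B HB].
  assert (B0 : 0 <= B) by (eapply Rle_trans; [apply Cmod_ge_0 | apply (HB O)]).
  pose proof (l1b_pos a A Ha) as A0.
  destruct (l1b_tail a A (eps / (4 * (B + 1))) Ha) as [N HN].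
  { apply Rdiv_lt_0_compat; lra. }
  destruct (Hx (eps / (4 * (A + 1)))) as [M HM].
  { apply Rdiv_lt_0_compat; lra. }
  exists (N + M)%nat. intros n Hn.
  replace (conv a x n - 0)%C with (conv a x n) by ring.
  replace n with (N + (n - N))%nat by lia.
  eapply Rle_lt_trans; [apply (conv_split a x B (eps / (4 * (A + 1))))|].
  - intros m Hm. left. replace (x m) with (x m - 0)%C by ring. apply HM. lia.
  - exact HB.
  - pose proof (Ha (N + (n - N))%nat) as H1. pose proof (HN (n - N)%nat) as H2.
    pose proof (asum_pos a (N + (n - N))) as H3.
    pose proof (asum_pos (fun m => a (N + m)%nat) (n - N)) as H4.
    apply Rle_lt_trans with (A * (eps / (4 * (A + 1))) + (eps / (4 * (B + 1))) * B).
    + apply Rplus_le_compat; apply Rmult_le_compat_r; try assumption.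
      left; apply Rdiv_lt_0_compat; lra.
    + assert (E1 : A * (eps / (4 * (A + 1))) <= eps / 4).
      { apply Rmult_le_reg_r with (4 * (A + 1)); [lra|]. field_simplify; nra. }
      assert (E2 : eps / (4 * (B + 1)) * B <= eps / 4).
      { apply Rmult_le_reg_r with (4 * (B + 1)); [lra|]. field_simplify; nra. }
      lra.
Qed.

(** * Sums of power series and the Cauchy estimate *)

(** Partial sums are written as a convolution with [ones] so that Cauchy products reduce to
    associativity. *)
Definition sums (a : nat -> C) (l : C) : Prop := limC (conv a ones) l.

Lemma limC_filterlim (x : nat -> C) (l : C) :
  limC x l <-> filterlim x eventually (@locally C_NormedModule l).
Proof.
  assert (E := filterlim_locally_ball_norm (K := C_AbsRing) (U := C_NormedModule)
                 (T := nat) (F := eventually) x l).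
  split.
  - intros H. apply (proj2 E). intros eps.
    destruct (H eps (cond_pos eps)) as [N HN]. exists N. exact HN.
  - intros H eps Heps. pose proof (proj1 E H (mkposreal eps Heps)) as [N HN].
    exists N. exact HN.
Qed.

Lemma sums_is_series (a : nat -> C) (l : C) : sums a l <-> is_series a l.
Proof.
  unfold sums. rewrite limC_filterlim.
  replace (conv a ones) with (sum_n a); [reflexivity|].
  apply functional_extensionality. intros n. symmetry. apply conv_ones_r.
Qed.

Lemma limC_unique (x : nat -> C) (l l' : C) : limC x l -> limC x l' -> l = l'.
Proof.
  intros H H'. destruct (Req_dec (Cmod (l - l')) 0) as [E|E].
  - apply Cmod_eq_0 in E. replace l with (l' + (l - l'))%C by ring. rewrite E. ring.
  - exfalso. pose proof (Cmod_ge_0 (l - l')) as P.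
    destruct (H (Cmod (l - l') / 2) ltac:(lra)) as [N HN].
    destruct (H' (Cmod (l - l') / 2) ltac:(lra)) as [N' HN'].
    pose proof (HN (N + N')%nat ltac:(lia)) as H1.
    pose proof (HN' (N + N')%nat ltac:(lia)) as H2.
    pose proof (Cmod_triangle (x (N + N')%nat - l') (- (x (N + N')%nat - l))%C) as H3.
    rewrite Cmod_opp in H3.
    replace (x (N + N')%nat - l' + - (x (N + N')%nat - l))%C with (l - l')%C in H3 by ring.
    lra.
Qed.

Lemma l1b_ex_series (a : nat -> C) (A : R) : l1b a A -> ex_series (fun n => Cmod (a n)).
Proof.
  intros Ha. destruct (ex_finite_lim_seq_incr (asum a) A) as [l Hl].
  - intros n. apply asum_mono. lia.
  - exact Ha.
  - exists l. change (is_lim_seq (sum_n (fun n => Cmod (a n))) l).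
    apply (is_lim_seq_ext (asum a)); [|exact Hl].
    intros n. symmetry. apply sum_n_Reals.
Qed.

Lemma l1b_sums (a : nat -> C) (A : R) : l1b a A -> exists l, sums a l.
Proof.
  intros Ha.
  destruct (ex_series_le (K := C_AbsRing) (V := C_CompleteNormedModule) a
              (fun n => Cmod (a n))) as [l Hl].
  - intros n. apply Rle_refl.
  - eapply l1b_ex_series, Ha.
  - exists l. apply sums_is_series. exact Hl.
Qed.

(** Mertens' argument: the partial sums of [b] are the constant [y] plus a null sequence [r]. The
    constant contributes [y] times the partial sums of [a], and [conv a r] is null by
    [conv_lim_0]. *)
Lemma sums_conv (a b : nat -> C) (A : R) (x y : C) :
  l1b a A -> sums a x -> sums b y -> sums (conv a b) (x * y)%C.
Proof.
  intros Ha Hx Hy. unfold sums in *. rewrite <- conv_assoc.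
  set (r := fun n => (conv b ones n - y)%C).
  assert (E : forall n, conv a (conv b ones) n = (y * conv a ones n + conv a r n)%C).
  { intros n. rewrite (conv_comm a ones), (conv_comm a r), <- conv_axpy_l.
    rewrite (conv_comm a). f_equal. apply functional_extensionality. intros m.
    unfold r, ones. ring. }
  assert (Hr : limC r 0).
  { intros eps Heps. destruct (Hy eps Heps) as [N HN]. exists N. intros n Hn.
    unfold r. replace (conv b ones n - y - 0)%C with (conv b ones n - y)%C by ring. auto. }
  pose proof (conv_lim_0 a r A Ha Hr) as H0.
  intros eps Heps. pose proof (Cmod_ge_0 y) as Y0.
  destruct (H0 (eps / 2)) as [N HN]; [lra|].
  destruct (Hx (eps / (2 * (Cmod y + 1)))) as [M HM]; [apply Rdiv_lt_0_compat; lra|].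
  exists (N + M)%nat. intros n Hn. rewrite E.
  replace (y * conv a ones n + conv a r n - x * y)%C
    with (y * (conv a ones n - x) + (conv a r n - 0))%C by ring.
  eapply Rle_lt_trans; [apply Cmod_triangle|]. rewrite Cmod_mult.
  pose proof (HN n ltac:(lia)) as H1. pose proof (HM n ltac:(lia)) as H2.
  assert (Cmod y * Cmod (conv a ones n - x) <= eps / 2); [|lra].
  apply Rle_trans with (Cmod y * (eps / (2 * (Cmod y + 1)))).
  - apply Rmult_le_compat_l; lra.
  - apply Rmult_le_reg_r with (2 * (Cmod y + 1)); [lra|]. field_simplify; nra.
Qed.

Lemma sums_sub (a b : nat -> C) (x y : C) : sums a x -> sums b y -> sums (ssub a b) (x - y)%C.
Proof.
  intros Hx Hy eps Heps.
  destruct (Hx (eps / 2)) as [N HN]; [lra|]. destruct (Hy (eps / 2)) as [M HM]; [lra|].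
  exists (N + M)%nat. intros n Hn.
  assert (E : conv (ssub a b) ones = ssub (conv a ones) (conv b ones)) by ring.
  rewrite E. unfold ssub.
  replace (conv a ones n - conv b ones n - (x - y))%C
    with (conv a ones n - x + - (conv b ones n - y))%C by ring.
  eapply Rle_lt_trans; [apply Cmod_triangle|]. rewrite Cmod_opp.
  pose proof (HN n ltac:(lia)). pose proof (HM n ltac:(lia)). lra.
Qed.

Lemma sums_one : sums sone 1.
Proof.
  intros eps Heps. exists O. intros n _. unfold sums. rewrite conv_one_l. unfold ones.
  replace (1 - 1)%C with (RtoC 0) by ring. rewrite Cmod_0. exact Heps.
Qed.

Lemma conv_ones_asum (a : nat -> C) (n : nat) : Cmod (conv a ones n) <= asum a n.
Proof.
  rewrite <- (Rmult_1_r (asum a n)). apply conv_sup_le.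
  intros m. unfold ones. rewrite Cmod_1. lra.
Qed.

Lemma limC_Cmod_le (x : nat -> C) (l : C) (B : R) (N : nat) :
  limC x l -> (forall n, (N <= n)%nat -> Cmod (x n) <= B) -> Cmod l <= B.
Proof.
  intros Hx HB. apply le_epsilon. intros eps Heps.
  destruct (Hx eps Heps) as [M HM].
  pose proof (HM (N + M)%nat ltac:(lia)) as H1. pose proof (HB (N + M)%nat ltac:(lia)) as H2.
  pose proof (Cmod_triangle (x (N + M)%nat) (- (x (N + M)%nat - l))%C) as H3.
  rewrite Cmod_opp in H3.
  replace (x (N + M)%nat + - (x (N + M)%nat - l))%C with l in H3 by ring. lra.
Qed.

Lemma sums_Cmod_le (a : nat -> C) (A : R) (x : C) : l1b a A -> sums a x -> Cmod x <= A.
Proof.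
  intros Ha Hx. apply (limC_Cmod_le (conv a ones) x A 0 Hx).
  intros n _. eapply Rle_trans; [apply conv_ones_asum | apply Ha].
Qed.

Lemma conv_ones_shift (a : nat -> C) (n p : nat) :
  conv a ones (S n + p) = (conv a ones n + conv (fun m => a (S n + m)%nat) ones p)%C.
Proof.
  rewrite !conv_ones_r. induction p as [|p IH].
  - rewrite !Nat.add_0_r, sum_O, sum_Sn, Nat.add_0_r. reflexivity.
  - rewrite Nat.add_succ_r, !sum_Sn, IH, Nat.add_succ_r.
    change (@plus C_AbelianMonoid) with Cplus.
    symmetry. apply Cplus_assoc.
Qed.

Lemma asum_shift_le (a : nat -> C) (d n : nat) :
  asum (fun m => a (d + m)%nat) n <= asum a (d + n).
Proof.
  revert a. induction d as [|d IH]; intros a.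
  - apply Rle_refl.
  - simpl Nat.add. rewrite asum_S. pose proof (Cmod_ge_0 (a O)).
    pose proof (IH (tl a)). unfold tl in *. lra.
Qed.

(** The error depends only on the tail of the moduli, hence is uniform over all [wt x a] with
    [|x| = 1]. [cauchy_estimate] relies on this, its evaluation points depending on the
    truncation. *)
Lemma sums_tail (a : nat -> C) (N : nat) (eps : R) (x : C) (n : nat) :
  (forall p, asum (fun m => a (N + m)%nat) p <= eps) -> sums a x -> (N <= S n)%nat ->
  Cmod (x - conv a ones n)%C <= eps.
Proof.
  intros Ht Hx Hn.
  apply (limC_Cmod_le (fun m => conv a ones m - conv a ones n)%C _ eps (S n)).
  - intros e He. destruct (Hx e He) as [M HM]. exists M. intros m Hm.
    replace (conv a ones m - conv a ones n - (x - conv a ones n))%C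
      with (conv a ones m - x)%C by ring. auto.
  - intros m Hm. replace m with (S n + (m - S n))%nat by lia.
    rewrite conv_ones_shift.
    replace (conv a ones n + conv (fun q => a (S n + q)%nat) ones (m - S n) - conv a ones n)%C
      with (conv (fun q => a (S n + q)%nat) ones (m - S n)) by ring.
    eapply Rle_trans; [apply conv_ones_asum|].
    eapply Rle_trans; [|apply (Ht (S n - N + (m - S n))%nat)].
    eapply Rle_trans; [|apply asum_shift_le].
    apply asum_le. intros q. replace (N + (S n - N + q))%nat with (S n + q)%nat by lia.
    apply Rle_refl.
Qed.

(** * Roots of unity and the size of coefficients *)

Definition cis (t : R) : C := (cos t, sin t).

Lemma cis_pow (t : R) (n : nat) : (cis t ^ n)%C = cis (INR n * t).
Proof.
  induction n as [|n IH].
  - unfold cis. rewrite Rmult_0_l, cos_0, sin_0. reflexivity.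
  - rewrite S_INR. simpl. rewrite IH. unfold cis, Cmult; simpl.
    replace ((INR n + 1) * t) with (t + INR n * t) by ring.
    rewrite cos_plus, sin_plus. f_equal; ring.
Qed.

Lemma cis_mod (t : R) : Cmod (cis t) = 1.
Proof.
  unfold Cmod, cis; simpl. pose proof (sin2_cos2 t) as H. unfold Rsqr in H.
  replace (cos t * (cos t * 1) + sin t * (sin t * 1)) with 1 by lra. apply sqrt_1.
Qed.

Lemma root_pow_neq_1 (N l : nat) : (0 < l < N)%nat ->
  (cis (2 * PI / INR N) ^ l)%C <> RtoC 1.
Proof.
  intros [H0 H1] E. rewrite cis_pow in E. unfold cis, RtoC in E. injection E as Ec Es.
  assert (N0 : 0 < INR N) by (apply lt_0_INR; lia).
  (* Half the angle: [cos (2 h) = 1] would force [sin h = 0], but [0 < h < PI]. *)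
  set (h := INR l * PI / INR N).
  replace (INR l * (2 * PI / INR N)) with (2 * h) in Ec by (unfold h; field; lra).
  rewrite cos_2a_sin in Ec.
  assert (P := PI_RGT_0).
  assert (0 < sin h).
  { apply sin_gt_0.
    - unfold h. apply Rdiv_lt_0_compat; [|lra]. apply Rmult_lt_0_compat; [|lra].
      apply lt_0_INR; lia.
    - unfold h. apply Rmult_lt_reg_r with (INR N); [lra|]. field_simplify; [|lra].
      apply lt_INR in H1. nra. }
  nra.
Qed.

Lemma root_pow_N (N : nat) : (0 < N)%nat -> (cis (2 * PI / INR N) ^ N)%C = RtoC 1.
Proof.
  intros H. rewrite cis_pow.
  replace (INR N * (2 * PI / INR N)) with (2 * PI).
  - unfold cis. rewrite cos_2PI, sin_2PI. reflexivity.
  - field. apply not_0_INR. lia.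
Qed.


Lemma geom_sum_C (x : C) (n : nat) :
  ((x - 1) * sum_n (fun j => x ^ j)%C n)%C = (x ^ (S n) - 1)%C.
Proof.
  induction n as [|n IH].
  - rewrite sum_O. simpl. ring.
  - rewrite sum_Sn. change (@plus C_AbelianMonoid) with Cplus.
    replace ((x - 1) * (sum_n (fun j => x ^ j)%C n + x ^ S n))%C
      with ((x - 1) * sum_n (fun j => x ^ j)%C n + (x - 1) * x ^ S n)%C by ring.
    rewrite IH. simpl. ring.
Qed.

Lemma Cmod_sum_n_le (f : nat -> C) (B : R) (n : nat) :
  (forall j, (j <= n)%nat -> Cmod (f j) <= B) -> Cmod (sum_n f n) <= INR (S n) * B.
Proof.
  intros H. induction n as [|n IH].
  - rewrite sum_O. simpl. rewrite Rmult_1_l. apply H. lia.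
  - rewrite sum_Sn. eapply Rle_trans; [apply Cmod_triangle|].
    rewrite (S_INR (S n)), Rmult_plus_distr_r, Rmult_1_l.
    apply Rplus_le_compat; [apply IH; intros; apply H; lia | apply H; lia].
Qed.

Lemma sum_n_0 (f : nat -> C) (n : nat) :
  (forall j, (j <= n)%nat -> f j = RtoC 0) -> sum_n f n = RtoC 0.
Proof.
  intros H. induction n as [|n IH]; [rewrite sum_O; apply H; lia|].
  rewrite sum_Sn, IH, H by (intros; try apply H; lia). apply Cplus_0_l.
Qed.

Lemma sum_n_single (f : nat -> C) (m n : nat) : (m <= n)%nat ->
  (forall j, (j <= n)%nat -> j <> m -> f j = RtoC 0) -> sum_n f n = f m.
Proof.
  intros Hm Hf. induction n as [|n IH].
  - rewrite sum_O. f_equal. lia.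
  - rewrite sum_Sn. destruct (Nat.eq_dec m (S n)) as [->|Hne].
    + rewrite sum_n_0 by (intros; apply Hf; lia). apply Cplus_0_l.
    + rewrite IH, (Hf (S n)) by (try lia; intros; apply Hf; lia). apply Cplus_0_r.
Qed.

(** Inverse discrete Fourier transform on the [n + 1] roots of unity. The exponent [S n - m] stands
    for [- m], as [w ^ S n = 1]. The formula is exact because two distinct indices up to [n] never
    differ by a multiple of [n + 1]. *)
Lemma root_average (a : nat -> C) (m n : nat) : (m <= n)%nat ->
  let w := cis (2 * PI / INR (S n)) in
  sum_n (fun j => (w ^ j) ^ (S n - m) * conv (wt (w ^ j) a) ones n)%C n
  = (RtoC (INR (S n)) * a m)%C.
Proof.
  intros Hm w.
  transitivity (sum_n (fun l => sum_n (fun j => a l * (w ^ (S n - m + l)) ^ j)%C n) n).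
  - rewrite sum_n_switch. apply sum_n_ext. intros j. rewrite conv_ones_r. symmetry.
    etransitivity; [|apply (sum_n_mult_l (K := C_Ring))].
    apply sum_n_ext. intros l. unfold wt.
    rewrite <- !Cpow_mult_r, Nat.mul_add_distr_r, Cpow_add_r.
    rewrite (Nat.mul_comm (S n - m) j), (Nat.mul_comm l j).
    set (x := (w ^ (j * (S n - m)))%C). set (y := (w ^ (j * l))%C).
    change (a l * (x * y) = x * (a l * y))%C. ring.
  - assert (G : forall l, sum_n (fun j => a l * (w ^ (S n - m + l)) ^ j)%C n
             = (a l * sum_n (fun j => (w ^ (S n - m + l)) ^ j)%C n)%C).
    { intros l. apply (sum_n_mult_l (K := C_Ring)). }
    rewrite (sum_n_single _ m n Hm).
    + rewrite G. replace (S n - m + m)%nat with (S n) by lia.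
      unfold w. rewrite root_pow_N by lia.
      rewrite (sum_n_ext _ (fun _ => RtoC 1)) by (intros; apply Cpow_1_l).
      rewrite Cmult_comm. f_equal. clear.
      induction n as [|n IH]; [rewrite sum_O; reflexivity|].
      rewrite sum_Sn, IH, (S_INR (S n)), RtoC_plus. reflexivity.
    + intros l Hl Hne. rewrite G.
      assert (N1 : (w ^ (S n - m + l))%C <> RtoC 1).
      { destruct (le_lt_dec m l) as [h|h].
        - replace (S n - m + l)%nat with (S n + (l - m))%nat by lia.
          rewrite Cpow_add_r. unfold w at 1. rewrite root_pow_N, Cmult_1_l by lia.
          apply root_pow_neq_1. lia.
        - apply root_pow_neq_1. lia. }
      pose proof (geom_sum_C (w ^ (S n - m + l))%C n) as E.
      rewrite <- Cpow_mult_r, (Nat.mul_comm _ (S n)), Cpow_mult_r in E.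
      unfold w in E at 3. rewrite root_pow_N, Cpow_1_l in E by lia.
      replace (1 - 1)%C with (RtoC 0) in E by ring.
      apply NNPP. intros N2.
      apply (Cmult_neq_0 (w ^ (S n - m + l) - 1)%C
               (sum_n (fun j => (w ^ (S n - m + l)) ^ j)%C n)); [| |exact E].
      * intros E1. apply N1.
        replace (w ^ (S n - m + l))%C with (w ^ (S n - m + l) - 1 + 1)%C by ring.
        rewrite E1. ring.
      * intros E1. apply N2. rewrite E1. ring.
Qed.

(** Replaces the contour integral by a finite average: the values of a truncation at roots of unity
    are within [eps] of full sums, and those are at most [M]. The constant [A] does not enter the
    bound, which is what makes the continuation argument below possible. *)
Lemma cauchy_estimate (a : nat -> C) (A M : R) (m : nat) :
  l1b a A ->
  (forall x l, Cmod x <= 1 -> sums (wt x a) l -> Cmod l <= M) ->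
  Cmod (a m) <= M.
Proof.
  intros Ha HM. apply le_epsilon. intros eps Heps.
  destruct (l1b_tail a A eps Ha Heps) as [N HN].
  (* [n >= N] makes the truncation error at most [eps]; [n >= m] keeps the coefficient [a m] in the
     truncation. *)
  set (n := (N + m)%nat). set (w := cis (2 * PI / INR (S n))).
  assert (B : Cmod (RtoC (INR (S n)) * a m)%C <= INR (S n) * (M + eps)).
  { rewrite <- (root_average a m n) by (unfold n; lia).
    apply Cmod_sum_n_le. intros j _. fold w.
    assert (W : forall q, Cmod (w ^ q)%C = 1).
    { intros q. rewrite Cmod_pow. unfold w. rewrite cis_mod. apply pow1. }
    rewrite Cmod_mult, Cmod_pow, W, pow1, Rmult_1_l.
    assert (Wt : forall q, Cmod (wt (w ^ j) a q) = Cmod (a q)).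
    { intros q. unfold wt. rewrite Cmod_mult, Cmod_pow, W, pow1. ring. }
    assert (Hw : l1b (wt (w ^ j) a) A).
    { intros q. eapply Rle_trans; [|apply (Ha q)]. apply asum_le. intros; rewrite Wt; lra. }
    destruct (l1b_sums _ _ Hw) as [l Hl].
    pose proof (HM (w ^ j)%C l ltac:(rewrite W; lra) Hl) as H1.
    assert (H2 : Cmod (l - conv (wt (w ^ j) a) ones n)%C <= eps).
    { apply (sums_tail _ N); [|exact Hl|unfold n; lia].
      intros p. eapply Rle_trans; [|apply (HN p)]. apply asum_le. intros; rewrite Wt; lra. }
    replace (conv (wt (w ^ j) a) ones n)
      with (l + - (l - conv (wt (w ^ j) a) ones n))%C by ring.
    eapply Rle_trans; [apply Cmod_triangle|]. rewrite Cmod_opp. lra. }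
  assert (P : 0 < INR (S n)) by (apply lt_0_INR; lia).
  rewrite Cmod_mult, Cmod_R, Rabs_pos_eq in B by lra.
  apply Rmult_le_reg_l in B; assumption.
Qed.

Definition bddbelow (f : nat -> C) (mu : R) : Prop :=
  forall x l, Cmod x <= 1 -> sums (wt x f) l -> mu <= Cmod l.

Lemma wt_le (x : C) (a : nat -> C) (n : nat) : Cmod x <= 1 -> Cmod (wt x a n) <= Cmod (a n).
Proof.
  intros Hx. unfold wt. rewrite Cmod_mult, Cmod_pow.
  rewrite <- (Rmult_1_r (Cmod (a n))) at 2.
  apply Rmult_le_compat_l; [apply Cmod_ge_0|].
  rewrite <- (pow1 n). apply pow_incr. split; [apply Cmod_ge_0 | exact Hx].
Qed.

Lemma l1b_wt (x : C) (a : nat -> C) (A : R) : Cmod x <= 1 -> l1b a A -> l1b (wt x a) A.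
Proof.
  intros Hx Ha n. eapply Rle_trans; [|apply (Ha n)]. apply asum_le. intros; apply wt_le, Hx.
Qed.

Lemma bddbelow_wt (x : C) (f : nat -> C) (mu : R) :
  Cmod x <= 1 -> bddbelow f mu -> bddbelow (wt x f) mu.
Proof.
  intros Hx Hf y l Hy Hl. rewrite wt_wt in Hl. apply (Hf (y * x)%C); [|exact Hl].
  rewrite Cmod_mult. pose proof (Cmod_ge_0 x). pose proof (Cmod_ge_0 y). nra.
Qed.

Lemma sums_spow (a : nat -> C) (A : R) (x : C) (n : nat) :
  l1b a A -> sums a x -> sums (spow a n) (x ^ n)%C.
Proof.
  intros Ha Hx. induction n as [|n IH]; simpl; [apply sums_one|].
  eapply sums_conv; eassumption.
Qed.

(** The symbol of the [n]-th power of [c] is the inverse of that of [f] to the power [n], so its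
    modulus is at most [(/ mu) ^ n] on the disc, and the Cauchy estimate passes this to
    coefficients. The summability constant [B] of [c] disappears from the conclusion. *)
Lemma inverse_power_bound (f c : nat -> C) (A B mu : R) (n m : nat) :
  0 < mu -> l1b f A -> l1b c B -> bddbelow f mu -> conv c f = sone ->
  Cmod (spow c n m) <= (/ mu) ^ n.
Proof.
  intros Hmu Hf Hc Hb E.
  apply cauchy_estimate with (B ^ n); [apply l1b_spow, Hc|].
  intros x l Hx Hl. rewrite wt_spow in Hl.
  pose proof (l1b_wt x c B Hx Hc) as Hcx. pose proof (l1b_wt x f A Hx Hf) as Hfx.
  destruct (l1b_sums _ _ Hcx) as [p Hp]. destruct (l1b_sums _ _ Hfx) as [q Hq].
  assert (Epq : (p * q)%C = RtoC 1).
  { apply (limC_unique (conv sone ones)); [|apply sums_one].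
    rewrite <- (wt_one x), <- E, wt_conv. eapply sums_conv; eassumption. }
  rewrite (limC_unique _ _ _ Hl (sums_spow _ _ _ n Hcx Hp)), Cmod_pow.
  apply pow_incr. split; [apply Cmod_ge_0|].
  pose proof (Hb x q Hx Hq) as Hq'. apply (f_equal Cmod) in Epq.
  rewrite Cmod_mult, Cmod_1 in Epq.
  apply Rmult_le_reg_r with mu; [exact Hmu|]. rewrite Rinv_l by lra.
  pose proof (Cmod_ge_0 p). nra.
Qed.

(** * Wiener's lemma on the closed unit disc *)

(** Course-of-values recursion: each coefficient of the inverse depends on all earlier ones, so
    level [n] stores a whole sequence whose entries up to [n] are final. *)
Fixpoint inv_table (f : nat -> C) (n : nat) : nat -> C :=
  match n with
  | O => fun _ => (/ f O)%C
  | S p => fun m => if (m <=? p)%nat then inv_table f p m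
                    else (- / f O * conv (tl f) (inv_table f p) p)%C
  end.

Definition sinv (f : nat -> C) : nat -> C := fun n => inv_table f n n.

Lemma inv_table_stable (f : nat -> C) (n m : nat) :
  (m <= n)%nat -> inv_table f n m = sinv f m.
Proof.
  induction 1 as [|n H IH]; [reflexivity|].
  simpl. apply Nat.leb_le in H. rewrite H. exact IH.
Qed.

Lemma conv_ext_le (a b b' : nat -> C) (n : nat) :
  (forall m, (m <= n)%nat -> b m = b' m) -> conv a b n = conv a b' n.
Proof.
  intros H. rewrite !conv_sum_n. apply sum_n_ext_loc. intros m Hm. rewrite H by lia.
  reflexivity.
Qed.

Lemma sinv_l (f : nat -> C) : f O <> RtoC 0 -> conv (sinv f) f = sone.
Proof.
  intros H. rewrite conv_comm. apply functional_extensionality. intros [|n].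
  - simpl. unfold sinv; simpl. field. exact H.
  - assert (Hn : sinv f (S n) = (- / f O * conv (tl f) (inv_table f n) n)%C).
    { unfold sinv, inv_table at 1; fold inv_table.
      replace (S n <=? n)%nat with false by (symmetry; apply Nat.leb_gt; lia). reflexivity. }
    simpl conv. rewrite Hn.
    rewrite (conv_ext_le (tl f) (sinv f) (inv_table f n)).
    + change (sone (S n)) with (RtoC 0). field. exact H.
    + intros m Hm. symmetry. apply inv_table_stable, Hm.
Qed.

Lemma conv_low_0 (a b : nat -> C) (q n : nat) :
  (forall m, (m < q)%nat -> b m = RtoC 0) -> (n < q)%nat -> conv a b n = RtoC 0.
Proof.
  intros Hb Hn. rewrite conv_sum_n. apply sum_n_0. intros j Hj.
  rewrite Hb by lia. apply Cmult_0_r.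
Qed.

Lemma spow_low_0 (a : nat -> C) (q n : nat) :
  a O = RtoC 0 -> (n < q)%nat -> spow a q n = RtoC 0.
Proof.
  intros Ha. revert n. induction q as [|q IH]; intros n Hn; [lia|].
  simpl. destruct n as [|n]; simpl; rewrite Ha; [ring|].
  rewrite (conv_low_0 (tl a) (spow a q) q) by (intros; try apply IH; lia). ring.
Qed.

(** Partial sums of [c + d c^2 + d^2 c^3 + ...], the expansion of [1 / (f0 - d)] when
    [c = 1 / f0]. *)
Fixpoint neumann (d c : nat -> C) (n : nat) : nat -> C :=
  match n with
  | O => c
  | S p => sadd (neumann d c p) (conv (spow d n) (spow c (S n)))
  end.

(* [d] has no constant term, so the Neumann series of the perturbed inverse
   stabilises coefficientwise and no convergence question arises. *)
Lemma neumann_exact (f0 f1 c e : nat -> C) (n m : nat) :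
  conv c f0 = sone -> conv e f1 = sone -> f0 O = f1 O -> (m <= n)%nat ->
  e m = neumann (ssub f0 f1) c n m.
Proof.
  intros Hc He H0 Hm. set (d := ssub f0 f1).
  (* The resolvent equation [e = c + d c e]; iterating it leaves the remainder [(d c)^(n+1) e],
     which has no terms of degree at most [n]. *)
  assert (B : e = sadd c (conv (conv d c) e)).
  { transitivity (conv e (conv c f0)); [rewrite Hc; ring|].
    replace f0 with (sadd f1 d) by (unfold d; ring).
    transitivity (sadd (conv c (conv e f1)) (conv (conv d c) e)); [ring|].
    rewrite He. ring. }
  assert (G : forall p, e = sadd (neumann d c p) (conv (spow (conv d c) (S p)) e)).
  { induction p as [|p IH].
    - simpl. transitivity (sadd c (conv (conv d c) e)); [exact B | ring].
    - rewrite IH at 1. rewrite B at 1.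
      change (neumann d c (S p)) with
        (sadd (neumann d c p) (conv (spow d (S p)) (spow c (S (S p))))).
      change (spow c (S (S p))) with (conv c (spow c (S p))).
      change (spow (conv d c) (S (S p))) with (conv (conv d c) (spow (conv d c) (S p))).
      rewrite spow_conv. ring. }
  transitivity (sadd (neumann d c n) (conv (spow (conv d c) (S n)) e) m);
    [exact (f_equal (fun a => a m) (G n))|]. unfold sadd.
  rewrite (conv_comm _ e), (conv_low_0 e (spow (conv d c) (S n)) (S n)).
  - ring.
  - intros q Hq. apply spow_low_0; [|exact Hq].
    simpl. unfold d, ssub. rewrite H0. ring.
  - lia.
Qed.

Lemma half_geom (mu : R) (n : nat) : 0 < mu ->
  (mu / 2) ^ n * (/ mu) ^ S n = (/ 2) ^ n * / mu.
Proof.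
  intros H. simpl. replace ((mu / 2) ^ n * (/ mu * (/ mu) ^ n))
    with ((mu / 2) ^ n * (/ mu) ^ n * / mu) by ring.
  rewrite <- Rpow_mult_distr. do 2 f_equal. field. lra.
Qed.

(** A perturbation of l1 norm [mu / 2] against powers of size [(/ mu) ^ p] makes the series
    geometric of ratio one half. A sup bound on the powers of [c] suffices, because the l1 norm sits
    on the factor [d]. *)
Lemma neumann_sup (d c : nat -> C) (mu : R) (n m : nat) :
  0 < mu -> l1b d (mu / 2) -> (forall p q, Cmod (spow c p q) <= (/ mu) ^ p) ->
  Cmod (neumann d c n m) <= (2 - (/ 2) ^ n) * / mu.
Proof.
  intros Hmu Hd Hc. induction n as [|n IH].
  - simpl. pose proof (Hc 1%nat m) as H. simpl in H.
    replace (conv c sone) with c in H by ring. lra.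
  - change (neumann d c (S n)) with
      (sadd (neumann d c n) (conv (spow d (S n)) (spow c (S (S n))))).
    unfold sadd. eapply Rle_trans; [apply Cmod_triangle|].
    assert (H : Cmod (conv (spow d (S n)) (spow c (S (S n))) m)
                <= (mu / 2) ^ S n * (/ mu) ^ S (S n)).
    { eapply Rle_trans; [apply conv_sup_le; intros; apply Hc|].
      apply Rmult_le_compat_r; [|apply l1b_spow, Hd].
      apply pow_le. left. apply Rinv_0_lt_compat, Hmu. }
    rewrite half_geom in H by exact Hmu.
    replace ((2 - (/ 2) ^ S n) * / mu)
      with ((2 - (/ 2) ^ n) * / mu + (/ 2) ^ S n * / mu) by (simpl; field; lra).
    lra.
Qed.

(** The l1 counterpart of [neumann_sup]; here the powers of [c] must be bounded in l1 with a
    constant [K] independent of the exponent. *)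
Lemma neumann_l1b (d c : nat -> C) (mu K : R) (n m : nat) :
  0 < mu -> l1b d (mu / 2) -> (forall p, l1b (spow c p) (K * (/ mu) ^ p)) ->
  asum (neumann d c n) m <= K * ((2 - (/ 2) ^ n) * / mu).
Proof.
  intros Hmu Hd Hc. induction n as [|n IH].
  - simpl. pose proof (Hc 1%nat m) as H. simpl in H.
    replace (conv c sone) with c in H by ring.
    replace (2 - 1) with 1 by ring. lra.
  - change (neumann d c (S n)) with
      (sadd (neumann d c n) (conv (spow d (S n)) (spow c (S (S n))))).
    eapply Rle_trans; [apply asum_add|].
    pose proof (l1b_conv _ _ _ _ (l1b_spow _ _ (S n) Hd) (Hc (S (S n))) m) as H.
    replace ((mu / 2) ^ S n * (K * (/ mu) ^ S (S n)))
      with (K * ((mu / 2) ^ S n * (/ mu) ^ S (S n))) in H by ring.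
    rewrite half_geom in H by exact Hmu.
    replace (K * ((2 - (/ 2) ^ S n) * / mu))
      with (K * ((2 - (/ 2) ^ n) * / mu) + K * ((/ 2) ^ S n * / mu)) by (simpl; field; lra).
    lra.
Qed.

Lemma Cpow_lipschitz (x y : C) (n : nat) :
  Cmod x <= 1 -> Cmod y <= 1 -> Cmod (x ^ n - y ^ n)%C <= INR n * Cmod (x - y)%C.
Proof.
  intros Hx Hy. induction n as [|n IH].
  - simpl. replace (1 - 1)%C with (RtoC 0) by ring. rewrite Cmod_0. lra.
  - rewrite S_INR. simpl Cpow.
    replace (x * x ^ n - y * y ^ n)%C with (x * (x ^ n - y ^ n) + (x - y) * y ^ n)%C by ring.
    eapply Rle_trans; [apply Cmod_triangle|]. rewrite !Cmod_mult, Cmod_pow.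
    pose proof (Cmod_ge_0 x). pose proof (Cmod_ge_0 y).
    pose proof (Cmod_ge_0 (x - y)%C). pose proof (Cmod_ge_0 (x ^ n - y ^ n)%C).
    assert (Cmod y ^ n <= 1) by (rewrite <- (pow1 n); apply pow_incr; lra).
    nra.
Qed.

Lemma asum_split_le (a : nat -> C) (N n : nat) :
  asum a n <= asum a N + asum (fun m => a (N + m)%nat) n.
Proof.
  revert a. induction N as [|N IH]; intros a.
  - pose proof (asum_pos a 0). simpl. change (fun m => a m) with a. lra.
  - destruct n as [|n].
    + pose proof (asum_mono a 0 (S N) ltac:(lia)).
      pose proof (asum_pos (fun m => a (S N + m)%nat) 0). lra.
    + rewrite !(asum_S a). pose proof (IH (tl a)) as H.
      pose proof (asum_mono (tl a) n (S n) ltac:(lia)) as H1.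
      unfold tl in *. simpl in *.
      pose proof (asum_mono (fun m => a (S (N + m))) n (S n) ltac:(lia)) as H2.
      pose proof (IH (tl a)) as H3. unfold tl in *. lra.
Qed.

Lemma wt_unif_cont (f : nat -> C) (A eta : R) : l1b f A -> 0 < eta ->
  exists delta, 0 < delta /\ forall x y, Cmod x <= 1 -> Cmod y <= 1 ->
    Cmod (x - y)%C <= delta -> l1b (ssub (wt x f) (wt y f)) eta.
Proof.
  intros Hf Heta. pose proof (l1b_pos f A Hf) as A0.
  destruct (l1b_tail f A (eta / 4) Hf) as [N HN]; [lra|].
  pose proof (pos_INR N) as N0.
  (* The head, Lipschitz with constant at most [N A], then contributes at most [eta / 2]; the tail,
     at most [eta / 4], is counted once for [x] and once for [y]. *)
  set (delta := eta / (2 * (INR N + 1) * (A + 1))).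
  assert (D : 0 < delta) by (apply Rdiv_lt_0_compat; [lra|nra]).
  exists delta. split; [exact D|]. intros x y Hx Hy Hxy n.
  set (h := ssub (wt x f) (wt y f)).
  eapply Rle_trans; [apply (asum_split_le h N n)|].
  assert (E : forall m, h m = (f m * (x ^ m - y ^ m))%C) by (intros; unfold h, ssub, wt; ring).
  assert (H1 : asum h N <= INR N * delta * A).
  { apply Rle_trans with (INR N * delta * asum f N).
    - unfold asum. rewrite scal_sum. apply sum_Rle. intros m Hm.
      rewrite E, Cmod_mult. apply Rmult_le_compat_l; [apply Cmod_ge_0|].
      eapply Rle_trans; [apply Cpow_lipschitz; assumption|].
      apply Rmult_le_compat; [apply pos_INR | apply Cmod_ge_0 | apply le_INR, Hm | exact Hxy].
    - apply Rmult_le_compat_l; [nra | apply Hf]. }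
  assert (H2 : asum (fun m => h (N + m)%nat) n <= 2 * asum (fun m => f (N + m)%nat) n).
  { unfold asum. rewrite scal_sum. apply sum_Rle. intros m Hm.
    unfold h, ssub. pose proof (wt_le x f (N + m) Hx). pose proof (wt_le y f (N + m) Hy).
    unfold Cminus. eapply Rle_trans; [apply Cmod_triangle|]. rewrite Cmod_opp. lra. }
  pose proof (HN n) as H3.
  assert (H4 : INR N * delta * A <= eta / 2).
  { apply Rle_trans with ((INR N + 1) * delta * (A + 1)).
    - apply Rmult_le_compat; nra.
    - right. unfold delta. field. split; lra. }
  lra.
Qed.

Lemma bddbelow_perturb (f g : nat -> C) (A mu eta : R) :
  l1b f A -> l1b (ssub f g) eta -> bddbelow f mu -> bddbelow g (mu - eta).
Proof.
  intros Hf Hd Hb x l Hx Hl.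
  destruct (l1b_sums _ _ (l1b_wt x f A Hx Hf)) as [q Hq].
  pose proof (Hb x q Hx Hq) as H1. pose proof (sums_sub _ _ _ _ Hq Hl) as Hs.
  assert (E : ssub (wt x f) (wt x g) = wt x (ssub f g)).
  { apply functional_extensionality. intros n. unfold ssub, wt. ring. }
  rewrite E in Hs.
  pose proof (sums_Cmod_le _ _ _ (l1b_wt x _ _ Hx Hd) Hs) as H2.
  pose proof (Cmod_triangle (q - l)%C l) as H3.
  replace (q - l + l)%C with q in H3 by ring. lra.
Qed.

Lemma wt_conv_one (x : C) (c f : nat -> C) :
  conv c f = sone -> conv (wt x c) (wt x f) = sone.
Proof. intros E. rewrite <- wt_conv, E. apply wt_one. Qed.

Lemma l1b_geom (a : nat -> C) (B q : R) : 0 <= B -> 0 <= q < 1 ->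
  (forall n, Cmod (a n) <= B * q ^ n) -> l1b a (B * / (1 - q)).
Proof.
  intros HB Hq Ha n. apply Rle_trans with (B * sum_f_R0 (fun m => q ^ m) n).
  - unfold asum. rewrite scal_sum. apply sum_Rle. intros m _. rewrite Rmult_comm. apply Ha.
  - apply Rmult_le_compat_l; [exact HB|]. rewrite tech3 by lra.
    unfold Rdiv. rewrite <- (Rmult_1_l (/ (1 - q))) at 2.
    apply Rmult_le_compat_r; [left; apply Rinv_0_lt_compat; lra|].
    pose proof (pow_le q (S n) (proj1 Hq)). lra.
Qed.

(** Loss of radius buys summability: at radius [r] the coefficients decay geometrically with ratio
    [r / r']. *)
Lemma l1b_inner_radius (c : nat -> C) (r r' B : R) : 0 <= r < r' ->
  (forall m, Cmod (wt r' c m) <= B) -> exists K, l1b (wt r c) K.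
Proof.
  intros Hr Hc. exists (B * / (1 - r / r')). apply l1b_geom.
  - eapply Rle_trans; [apply Cmod_ge_0 | apply (Hc O)].
  - split; [apply Rdiv_le_0_compat; lra|]. apply Rlt_div_l; lra.
  - intros n. specialize (Hc n). unfold wt in *. rewrite Cmod_mult, Cmod_pow, Cmod_R in *.
    rewrite Rabs_pos_eq in * by lra. unfold Rdiv. rewrite Rpow_mult_distr, pow_inv.
    assert (P : 0 < r' ^ n) by (apply pow_lt; lra).
    pose proof (pow_le r n (proj1 Hr)) as P'.
    replace (Cmod (c n) * r ^ n) with (Cmod (c n) * r' ^ n * (r ^ n * / r' ^ n)) by (field; lra).
    apply Rmult_le_compat_r; [|exact Hc].
    apply Rmult_le_pos; [exact P'|]. left. apply Rinv_0_lt_compat, P.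
Qed.

Lemma Cmod_unit_real (r : R) : 0 <= r <= 1 -> Cmod (RtoC r) <= 1.
Proof. intros H. rewrite Cmod_R, Rabs_pos_eq; lra. Qed.

(* Continuation in the radius: as long as the inverse is summable at radius [r], its powers
   obey the Cauchy estimate, and the Neumann series then controls a uniformly larger radius. *)
Lemma inverse_bounded (f c : nat -> C) (A mu : R) (m : nat) :
  0 < mu -> l1b f A -> bddbelow f mu -> conv c f = sone -> Cmod (c m) <= 2 / mu.
Proof.
  intros Hmu Hf Hb E.
  destruct (wt_unif_cont f A (mu / 2) Hf) as [delta [D0 D]]; [lra|].
  assert (Step : forall r r' K, 0 <= r <= 1 -> 0 <= r' <= 1 -> Rabs (r - r') <= delta ->
            l1b (wt r c) K -> forall n, Cmod (wt r' c n) <= 2 / mu).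
  { intros r r' K Hr Hr' Hd Hk n.
    pose proof (Cmod_unit_real r Hr) as R1. pose proof (Cmod_unit_real r' Hr') as R2.
    rewrite (neumann_exact (wt r f) (wt r' f) (wt r c) (wt r' c) n n);
      try (apply wt_conv_one; exact E); [| |lia].
    - eapply Rle_trans; [apply (neumann_sup _ _ mu)|].
      + exact Hmu.
      + apply D; try assumption. rewrite <- RtoC_minus, Cmod_R. exact Hd.
      + intros p q. apply inverse_power_bound with (wt r f) A K; try assumption.
        * apply l1b_wt; assumption.
        * apply bddbelow_wt; assumption.
        * apply wt_conv_one, E.
      + unfold Rdiv. apply Rmult_le_compat_r; [left; apply Rinv_0_lt_compat, Hmu|].
        assert (0 <= (/ 2) ^ n) by (apply pow_le; lra). lra.
    - unfold wt. simpl. reflexivity. }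
  assert (It : forall t r, 0 <= r < 1 -> r <= INR t * (delta / 2) -> exists K, l1b (wt r c) K).
  { induction t as [|t IH]; intros r Hr Ht.
    - simpl in Ht. exists (Cmod (c O) * / (1 - 0)). apply l1b_geom; [apply Cmod_ge_0|lra|].
      intros [|n]; unfold wt; simpl; rewrite Cmod_mult; [rewrite Cmod_1; lra|].
      replace r with 0 by lra. rewrite Cmod_mult, Cmod_0. lra.
    (* Summability at [r0], half a step below [r], bounds the inverse at [r1], half a step above,
       since [r1 - r0 <= delta]; as [r < r1], this gives summability at [r]. The clamps keep both
       radii in the unit interval. *)
    - rewrite S_INR in Ht. set (r0 := Rmax 0 (r - delta / 2)). set (r1 := Rmin 1 (r + delta / 2)).
      assert (H0 : 0 <= r0 <= r /\ r - delta / 2 <= r0)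
        by (unfold r0; split; [split; [apply Rmax_l | apply Rmax_lub; lra] | apply Rmax_r]).
      assert (H1 : r < r1 <= 1 /\ r1 <= r + delta / 2)
        by (unfold r1; split; [split; [apply Rmin_glb_lt; lra | apply Rmin_l] | apply Rmin_r]).
      destruct (IH r0) as [K HK]; [lra| |].
      { unfold r0. apply Rmax_lub; [|lra]. pose proof (pos_INR t). nra. }
      apply (l1b_inner_radius c r r1 (2 / mu)); [lra|].
      apply (Step r0 r1 K); try lra; [|exact HK].
      rewrite Rabs_left1; lra. }
  (* A radius below 1 from which one step reaches 1. At radius 1 itself only a sup bound results,
     there being no larger radius to lose. *)
  set (r := Rmax 0 (1 - delta)).
  assert (H0 : 0 <= r < 1 /\ 1 - delta <= r)
    by (unfold r; split; [split; [apply Rmax_l | apply Rmax_lub_lt; lra] | apply Rmax_r]).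
  destruct (nfloor_ex (r / (delta / 2))) as [t Ht]; [apply Rdiv_le_0_compat; lra|].
  destruct (It (S t) r) as [K HK]; [lra| |].
  { rewrite S_INR. apply Rmult_le_reg_r with (/ (delta / 2)); [apply Rinv_0_lt_compat; lra|].
    rewrite Rmult_assoc, Rinv_r by lra. unfold Rdiv in *. lra. }
  assert (H1 : Cmod (wt 1 c m) <= 2 / mu).
  { apply (Step r 1 K); try lra; [|exact HK]. rewrite Rabs_left1; lra. }
  unfold wt in H1. rewrite Cpow_1_l, Cmult_1_r in H1. exact H1.
Qed.

Lemma finite_support_l1b (a : nat -> C) (N : nat) :
  (forall n, (N < n)%nat -> a n = RtoC 0) -> l1b a (asum a N).
Proof.
  intros H n. destruct (le_lt_dec n N) as [h|h]; [apply asum_mono, h|].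
  assert (forall p, asum a (N + p) = asum a N); [|replace n with (N + (n - N))%nat by lia; rewrite H0; lra].
  induction p as [|p IH]; [rewrite Nat.add_0_r; reflexivity|].
  rewrite Nat.add_succ_r. unfold asum in *. simpl. rewrite IH, H, Cmod_0 by lia. ring.
Qed.

(** [inverse_bounded] alone gives only bounded coefficients on the unit disc. A truncation [P] of
    [f] can be followed to a slightly larger disc, where its inverse [p] and all powers of [p] are
    controlled; the Neumann series then passes from [P] to [f] in l1. *)
Theorem wiener_bddbelow (f c : nat -> C) (A mu : R) :
  0 < mu -> l1b f A -> bddbelow f mu -> conv c f = sone -> exists K, l1b c K.
Proof.
  intros Hmu Hf Hb E.
  destruct (l1b_tail f A (mu / 8) Hf) as [N HN]; [lra|].
  set (P := fun n => if (n <=? N)%nat then f n else RtoC 0).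
  assert (Pz : forall n, (N < n)%nat -> P n = RtoC 0).
  { intros n Hn. unfold P. apply Nat.leb_gt in Hn. rewrite Hn. reflexivity. }
  assert (dP : l1b (ssub P f) (mu / 8)).
  { intros n. eapply Rle_trans; [apply (asum_split_le _ N n)|].
    assert (Z : asum (ssub P f) N = 0).
    { unfold asum. apply sum_eq_R0. intros m Hm. unfold ssub, P.
      apply Nat.leb_le in Hm. rewrite Hm. replace (f m - f m)%C with (RtoC 0) by ring.
      apply Cmod_0. }
    rewrite Z, Rplus_0_l. eapply Rle_trans; [|apply (HN n)]. apply asum_le.
    intros m. unfold ssub, P. destruct (N + m <=? N)%nat.
    - replace (f (N + m)%nat - f (N + m)%nat)%C with (RtoC 0) by ring.
      rewrite Cmod_0. apply Cmod_ge_0.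
    - replace (0 - f (N + m)%nat)%C with (- f (N + m)%nat)%C by ring.
      rewrite Cmod_opp. lra. }
  assert (dP' : l1b (ssub f P) (mu / 8)).
  { intros n. eapply Rle_trans; [|apply (dP n)]. apply asum_le. intros m. unfold ssub.
    replace (f m - P m)%C with (- (P m - f m))%C by ring. rewrite Cmod_opp. lra. }
  pose proof (bddbelow_perturb _ _ _ _ _ Hf dP' Hb) as bP.
  (* Rescaling by 2 lets the continuity lemma for the unit disc compare radii up to 2: [wt x P] is
     [wt (x / 2) g]. This is why [eta] is capped by one half. *)
  set (g := wt 2 P).
  assert (Hg : l1b g (asum g N)).
  { apply finite_support_l1b. intros n Hn. unfold g, wt. rewrite Pz by exact Hn. ring. }
  destruct (wt_unif_cont g _ (mu / 8) Hg) as [delta [D0 D]]; [lra|].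
  set (eta := Rmin (/ 2) delta).
  assert (He : 0 < eta <= / 2 /\ eta <= delta).
  { unfold eta. split; [split; [apply Rmin_glb_lt; lra | apply Rmin_l] | apply Rmin_r]. }
  set (rad := 1 + 2 * eta).
  assert (Wg : forall x : R, wt (RtoC (x / 2)) g = wt x P).
  { intros x. unfold g. rewrite wt_wt. f_equal. rewrite <- RtoC_mult. f_equal. field. }
  assert (W1 : wt 1 P = P).
  { apply functional_extensionality. intros n. unfold wt. rewrite Cpow_1_l. ring. }
  assert (dR : l1b (ssub P (wt rad P)) (mu / 8)).
  { rewrite <- W1 at 1. rewrite <- (Wg 1), <- (Wg rad). apply D.
    - apply Cmod_unit_real. lra.
    - apply Cmod_unit_real. unfold rad. lra.
    - rewrite <- RtoC_minus, Cmod_R. unfold rad.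
      replace (1 / 2 - (1 + 2 * eta) / 2) with (- eta) by field.
      rewrite Rabs_Ropp, Rabs_pos_eq; lra. }
  assert (HP : l1b P (asum P N)) by (apply finite_support_l1b, Pz).
  pose proof (bddbelow_perturb _ _ _ _ _ HP dR bP) as bR0.
  (* Truncation and enlargement of the disc each cost [mu / 8], leaving [3 mu / 4]. The choice
     [mu / 2] also satisfies [mu / 8 <= nu / 2], as the Neumann series from [P] to [f] requires. *)
  set (nu := mu / 2).
  assert (bR : bddbelow (wt rad P) nu).
  { intros x l Hx Hl. pose proof (bR0 x l Hx Hl). unfold nu. lra. }
  assert (HR : l1b (wt rad P) (asum (wt rad P) N)).
  { apply finite_support_l1b. intros n Hn. unfold wt. rewrite Pz by exact Hn. ring. }
  assert (f0 : f O <> RtoC 0).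
  { intros Z. apply (f_equal (fun a => a O)) in E. simpl in E. rewrite Z in E.
    replace (c O * 0)%C with (RtoC 0) in E by ring. unfold sone in E.
    apply RtoC_inj in E. lra. }
  assert (P0 : P O = f O) by reflexivity.
  set (p := sinv P).
  assert (Ep : conv p P = sone) by (apply sinv_l; rewrite P0; exact f0).
  assert (nu0 : 0 < nu) by (unfold nu; lra).
  pose proof (fun m => inverse_bounded (wt rad P) (wt rad p) _ nu m nu0 HR bR
                         (wt_conv_one rad p P Ep)) as Bp.
  (* An intermediate radius: the gap from [rad] to [rho] makes [p] summable at [rho], and the gap
     from [rho] to 1 turns sup bounds on its powers into l1 bounds with the common constant
     [/ (1 - / rho)]. *)
  set (rho := 1 + eta).
  assert (Hrho : 1 < rho < rad) by (unfold rho, rad; lra).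
  destruct (l1b_inner_radius p rho rad (2 / nu)) as [K HK]; [lra|exact Bp|].
  assert (Erho : wt rho P = wt (rho / rad)%R (wt rad P)).
  { rewrite wt_wt, <- RtoC_mult. do 2 f_equal. field. lra. }
  assert (Crho : Cmod (RtoC (rho / rad)) <= 1).
  { apply Cmod_unit_real. split; [apply Rdiv_le_0_compat; lra|].
    apply Rle_div_l; lra. }
  assert (Pow : forall n m, Cmod (spow (wt rho p) n m) <= (/ nu) ^ n).
  { intros n m. apply inverse_power_bound with (wt rho P) (asum (wt rad P) N) K; try assumption.
    - rewrite Erho. apply l1b_wt; assumption.
    - rewrite Erho. apply bddbelow_wt; assumption.
    - apply wt_conv_one, Ep. }
  assert (L : forall n, l1b (spow p n) (/ (1 - / rho) * (/ nu) ^ n)).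
  { intros n. rewrite Rmult_comm. apply l1b_geom.
    - apply pow_le. left. apply Rinv_0_lt_compat, nu0.
    - split; [left; apply Rinv_0_lt_compat; lra|].
      rewrite <- Rinv_1. apply Rinv_lt_contravar; lra.
    - intros m. pose proof (Pow n m) as H. rewrite <- wt_spow in H. unfold wt in H.
      rewrite Cmod_mult, Cmod_pow, Cmod_R, Rabs_pos_eq in H by lra.
      assert (0 < rho ^ m) by (apply pow_lt; lra).
      apply Rmult_le_reg_r with (rho ^ m); [assumption|].
      rewrite Rmult_assoc, <- Rpow_mult_distr, Rinv_l, pow1 by lra. lra. }
  exists (/ (1 - / rho) * (2 * / nu)). intros n.
  assert (Eq : asum c n = asum (neumann (ssub P f) p n) n).
  { unfold asum. apply sum_eq. intros m Hm. f_equal.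
    apply neumann_exact; try assumption. }
  rewrite Eq. eapply Rle_trans.
  - apply (neumann_l1b _ _ nu (/ (1 - / rho))); [exact nu0| |exact L].
    intros m. eapply Rle_trans; [apply dP|]. unfold nu. lra.
  - apply Rmult_le_compat_l.
    + left. apply Rinv_0_lt_compat. assert (/ rho < 1); [|lra].
      rewrite <- Rinv_1. apply Rinv_lt_contravar; lra.
    + apply Rmult_le_compat_r; [left; apply Rinv_0_lt_compat, nu0|].
      assert (0 <= (/ 2) ^ n) by (apply pow_le; lra). lra.
Qed.

(** Compactness of a square containing the disc. One positive number attached to each point serves
    both as a radius and as a lower bound for the modulus nearby; at a point outside the disc the
    radius is so small that no point of the disc is reached. *)
Lemma nonvanishing_bddbelow (f : nat -> C) (A : R) : l1b f A ->
  (forall x, Cmod x <= 1 -> ~ sums (wt x f) 0) -> exists mu, 0 < mu /\ bddbelow f mu.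
Proof.
  intros Hf Hz.
  assert (Loc : forall u v : R, exists d : posreal, forall x l, Cmod x <= 1 ->
     sums (wt x f) l -> Rabs (fst x - u) < d -> Rabs (snd x - v) < d -> d <= Cmod l).
  { intros u v. set (y := (u, v) : C).
    assert (Near : forall (d : R) (x : C), Rabs (fst x - u) < d -> Rabs (snd x - v) < d ->
              Cmod (x - y)%C <= 2 * d).
    { intros d x H1 H2.
      replace (x - y)%C with (RtoC (fst x - u) + Ci * RtoC (snd x - v))%C
        by (apply injective_projections; unfold y; simpl; ring).
      eapply Rle_trans; [apply Cmod_triangle|].
      rewrite Cmod_mult, !Cmod_R, Cmod_Ci. lra. }
    destruct (Rle_lt_dec (Cmod y) 1) as [Hy|Hy].
    - destruct (l1b_sums _ _ (l1b_wt y f A Hy Hf)) as [q Hq].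
      assert (Q : 0 < Cmod q).
      { apply Cmod_gt_0. intros Z. rewrite Z in Hq. apply (Hz y Hy Hq). }
      destruct (wt_unif_cont f A (Cmod q / 2) Hf) as [delta [D0 D]]; [lra|].
      assert (M : 0 < Rmin (delta / 2) (Cmod q / 2)) by (apply Rmin_glb_lt; lra).
      exists (mkposreal _ M). simpl. intros x l Hx Hl H1 H2.
      pose proof (Near _ x H1 H2) as H3.
      pose proof (Rmin_l (delta / 2) (Cmod q / 2)). pose proof (Rmin_r (delta / 2) (Cmod q / 2)).
      pose proof (sums_Cmod_le _ _ _ (D x y Hx Hy ltac:(lra)) (sums_sub _ _ _ _ Hl Hq)) as H4.
      pose proof (Cmod_triangle (- (l - q))%C l) as H5. rewrite Cmod_opp in H5.
      replace (- (l - q) + l)%C with q in H5 by ring. lra.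
    - assert (M : 0 < (Cmod y - 1) / 2) by lra.
      exists (mkposreal _ M). simpl. intros x l Hx Hl H1 H2. exfalso.
      (* [Near] yields a weak inequality, so a value strictly between the coordinate distances and
         the radius is inserted to reach a strict one. *)
      assert (H1' : exists d, d < (Cmod y - 1) / 2 /\ Rabs (fst x - u) < d /\ Rabs (snd x - v) < d).
      { exists (((Cmod y - 1) / 2 + Rmax (Rabs (fst x - u)) (Rabs (snd x - v))) / 2).
        pose proof (Rmax_lub_lt _ _ _ H1 H2).
        pose proof (Rmax_l (Rabs (fst x - u)) (Rabs (snd x - v))).
        pose proof (Rmax_r (Rabs (fst x - u)) (Rabs (snd x - v))). lra. }
      destruct H1' as [d [Hd [Ha Hb]]]. pose proof (Near _ x Ha Hb) as H3.
      pose proof (Cmod_triangle x (- (x - y))%C) as H5. rewrite Cmod_opp in H5.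
      replace (x + - (x - y))%C with y in H5 by ring. lra. }
  set (delta := fun u v => proj1_sig (constructive_indefinite_description _ (Loc u v))).
  (* Every point of the square lies within [delta u v] of some [(u, v)] with [d <= delta u v], so
     [d] is a uniform lower bound. *)
  destruct (compactness_value_2d (-1) 1 (-1) 1 delta) as [d Hd].
  exists d. split; [apply cond_pos|]. intros x l Hx Hl.
  assert (Bx : -1 <= fst x <= 1 /\ -1 <= snd x <= 1).
  { pose proof (Rmax_Cmod x) as H.
    pose proof (Rmax_l (Rabs (fst x)) (Rabs (snd x))) as H1.
    pose proof (Rmax_r (Rabs (fst x)) (Rabs (snd x))) as H2.
    split; apply Rabs_le_between; lra. }
  destruct (NNPP _ (Hd (fst x) (snd x) (proj1 Bx) (proj2 Bx))) as [u [v [_ [_ [H1 [H2 H3]]]]]].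
  eapply Rle_trans; [exact H3|].
  apply (proj2_sig (constructive_indefinite_description _ (Loc u v)) x l Hx Hl H1 H2).
Qed.

Theorem wiener (f c : nat -> C) (A : R) : l1b f A ->
  (forall x, Cmod x <= 1 -> ~ sums (wt x f) 0) -> conv c f = sone -> exists K, l1b c K.
Proof.
  intros Hf Hz E. destruct (nonvanishing_bddbelow f A Hf Hz) as [mu [Hmu Hb]].
  eapply wiener_bddbelow; eassumption.
Qed.

(** * Lagrange interpolation on a uniform grid *)

Fixpoint rsum (f : nat -> R) (n : nat) : R :=
  match n with O => 0 | S p => rsum f p + f p end.

Lemma rsum_ext (f g : nat -> R) (n : nat) :
  (forall j, (j < n)%nat -> f j = g j) -> rsum f n = rsum g n.
Proof.
  intros H. induction n as [|n IH]; simpl; [reflexivity|].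
  rewrite IH, H by (intros; try apply H; lia). reflexivity.
Qed.

Lemma rsum_0 (f : nat -> R) (n : nat) :
  (forall j, (j < n)%nat -> f j = 0) -> rsum f n = 0.
Proof.
  intros H. induction n as [|n IH]; simpl; [reflexivity|].
  rewrite IH, H by (intros; try apply H; lia). ring.
Qed.

Lemma rsum_plus (f g : nat -> R) (n : nat) :
  rsum (fun j => f j + g j) n = rsum f n + rsum g n.
Proof. induction n as [|n IH]; simpl; [ring | rewrite IH; ring]. Qed.

Lemma rsum_scal (c : R) (f : nat -> R) (n : nat) :
  rsum (fun j => c * f j) n = c * rsum f n.
Proof. induction n as [|n IH]; simpl; [ring | rewrite IH; ring]. Qed.

Lemma rsum_swap (f : nat -> nat -> R) (m n : nat) :
  rsum (fun i => rsum (f i) n) m = rsum (fun j => rsum (fun i => f i j) m) n.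
Proof.
  induction m as [|m IH]; simpl.
  - symmetry. apply rsum_0. reflexivity.
  - rewrite IH, <- rsum_plus. reflexivity.
Qed.

Lemma rsum_S_l (f : nat -> R) (n : nat) : rsum f (S n) = f O + rsum (fun j => f (S j)) n.
Proof. induction n as [|n IH]; simpl in *; [ring | rewrite IH; ring]. Qed.

Lemma rsum_trunc (f : nat -> R) (m n : nat) : (m <= n)%nat ->
  (forall j, (m <= j < n)%nat -> f j = 0) -> rsum f n = rsum f m.
Proof.
  induction 1 as [|n H IH]; intros Hf; [reflexivity|].
  simpl. rewrite IH, Hf by (intros; try apply Hf; lia). ring.
Qed.

Lemma rsum_le (f g : nat -> R) (n : nat) :
  (forall j, (j < n)%nat -> f j <= g j) -> rsum f n <= rsum g n.
Proof.
  intros H. induction n as [|n IH]; simpl; [lra|].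
  pose proof (H n ltac:(lia)). pose proof (IH (fun j Hj => H j ltac:(lia))). lra.
Qed.

Lemma rsum_abs (f : nat -> R) (n : nat) : Rabs (rsum f n) <= rsum (fun j => Rabs (f j)) n.
Proof.
  induction n as [|n IH]; simpl; [rewrite Rabs_R0; lra|].
  eapply Rle_trans; [apply Rabs_triang|]. lra.
Qed.

Definition cont_diff (f : R -> R) : Prop := (forall x, ex_derive f x) /\ (forall x, continuous (Derive f) x).

Lemma cont_diff_intro (f g : R -> R) :
  (forall x, is_derive f x (g x)) -> (forall x, continuous g x) -> cont_diff f.
Proof.
  intros H Hg. split; [intros x; exists (g x); apply H|].
  intros x. apply (continuous_ext g); [|apply Hg].
  intros y. symmetry. apply is_derive_unique, H.
Qed.

Lemma cont_diff_continuous (f : R -> R) : cont_diff f -> forall x, continuous f x.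
Proof. intros [H _] x. apply (ex_derive_continuous (V := R_NormedModule)), H. Qed.

Lemma cont_diff_const (c : R) : cont_diff (fun _ => c).
Proof.
  apply (cont_diff_intro _ (fun _ => 0)); intros x; [apply @is_derive_const | apply continuous_const].
Qed.

Lemma cont_diff_affine (a b : R) : cont_diff (fun x => (x - a) / b).
Proof.
  apply (cont_diff_intro _ (fun _ => / b)); intros x; [|apply continuous_const].
  unfold Rdiv. auto_derive; [trivial|ring].
Qed.

Lemma cont_diff_plus (f g : R -> R) : cont_diff f -> cont_diff g -> cont_diff (fun x => f x + g x).
Proof.
  intros [F F'] [G G']. apply (cont_diff_intro _ (fun x => Derive f x + Derive g x)); intros x.
  - apply (is_derive_plus (V := R_NormedModule)); apply Derive_correct; auto.
  - apply (continuous_plus (V := R_NormedModule)); auto.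
Qed.

Lemma cont_diff_mult (f g : R -> R) : cont_diff f -> cont_diff g -> cont_diff (fun x => f x * g x).
Proof.
  intros HF HG. pose proof (cont_diff_continuous f HF). pose proof (cont_diff_continuous g HG).
  destruct HF as [F F'], HG as [G G'].
  apply (cont_diff_intro _ (fun x => Derive f x * g x + f x * Derive g x)); intros x.
  - apply (is_derive_mult (K := R_AbsRing)); try (apply Derive_correct; auto).
    intros; apply Rmult_comm.
  - apply (continuous_plus (V := R_NormedModule)); apply (continuous_mult (K := R_AbsRing)); auto.
Qed.

Lemma cont_diff_sum (F : nat -> R -> R) (m : nat) :
  (forall l, cont_diff (F l)) -> cont_diff (fun x => sum_f_R0 (fun l => F l x) m).
Proof.
  intros H. induction m as [|m IH]; simpl; [apply H | apply cont_diff_plus; auto].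
Qed.

Lemma cont_diff_prod (F : nat -> R -> R) (m : nat) :
  (forall l, cont_diff (F l)) -> cont_diff (fun x => prod_f_R0 (fun l => F l x) m).
Proof.
  intros H. induction m as [|m IH]; simpl; [apply H | apply cont_diff_mult; auto].
Qed.

Lemma lagr_cont_diff (dt : R) (v : nat -> R) (m s : nat) : cont_diff (lagr dt v m s).
Proof.
  unfold lagr. apply (cont_diff_sum (fun l x => v (s + l)%nat * _)). intros l.
  apply cont_diff_mult; [apply cont_diff_const|].
  apply (cont_diff_prod (fun r x => if Nat.eqb r l then 1 else _)). intros r.
  destruct (Nat.eqb r l); [apply cont_diff_const | apply cont_diff_affine].
Qed.

Lemma lagr_ext (dt : R) (v w : nat -> R) (m s : nat) (x : R) :
  (forall l, (l <= m)%nat -> v (s + l)%nat = w (s + l)%nat) ->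
  lagr dt v m s x = lagr dt w m s x.
Proof. intros H. apply sum_eq. intros l Hl. rewrite H by exact Hl. reflexivity. Qed.

Lemma lagr_plus (dt : R) (v w : nat -> R) (m s : nat) (x : R) :
  lagr dt (fun j => v j + w j) m s x = lagr dt v m s x + lagr dt w m s x.
Proof. unfold lagr. rewrite <- sum_plus. apply sum_eq. intros. ring. Qed.

Lemma lagr_0 (dt : R) (v : nat -> R) (m s : nat) (x : R) :
  (forall l, (l <= m)%nat -> v (s + l)%nat = 0) -> lagr dt v m s x = 0.
Proof.
  intros H. apply sum_eq_R0. intros l Hl. rewrite H by exact Hl. ring.
Qed.

Lemma prod_f_R0_ext (f g : nat -> R) (m : nat) :
  (forall r, (r <= m)%nat -> f r = g r) -> prod_f_R0 f m = prod_f_R0 g m.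
Proof.
  intros H. induction m as [|m IH]; simpl; [apply H; lia|].
  rewrite IH, H by (intros; try apply H; lia). reflexivity.
Qed.

Lemma prod_f_R0_zero (f : nat -> R) (r m : nat) :
  (r <= m)%nat -> f r = 0 -> prod_f_R0 f m = 0.
Proof.
  intros Hr Hf. induction m as [|m IH]; simpl.
  - replace r with O in Hf by lia. exact Hf.
  - destruct (Nat.eq_dec r (S m)) as [->|Hne]; [rewrite Hf; ring|].
    rewrite IH by lia. ring.
Qed.

Lemma prod_f_R0_one (f : nat -> R) (m : nat) :
  (forall r, (r <= m)%nat -> f r = 1) -> prod_f_R0 f m = 1.
Proof.
  intros H. induction m as [|m IH]; simpl; [apply H; lia|].
  rewrite IH, H by (intros; try apply H; lia). ring.
Qed.

Lemma node_diff (dt : R) (s l r : nat) :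
  node dt (s + l) - node dt (s + r) = (INR l - INR r) * dt.
Proof. unfold node. rewrite !plus_INR. ring. Qed.

Lemma sum_f_R0_single (f : nat -> R) (m n : nat) : (m <= n)%nat ->
  (forall j, (j <= n)%nat -> j <> m -> f j = 0) -> sum_f_R0 f n = f m.
Proof.
  intros Hm Hf. induction n as [|n IH]; simpl.
  - f_equal. lia.
  - destruct (Nat.eq_dec m (S n)) as [->|Hne].
    + rewrite sum_eq_R0 by (intros; apply Hf; lia). ring.
    + rewrite IH, (Hf (S n)) by (try lia; intros; apply Hf; lia). ring.
Qed.

Lemma lagr_node (dt : R) (v : nat -> R) (m s a : nat) : 0 < dt -> (a <= m)%nat ->
  lagr dt v m s (node dt (s + a)) = v (s + a)%nat.
Proof.
  intros Hdt Ha. unfold lagr. rewrite (sum_f_R0_single _ a m Ha).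
  - rewrite prod_f_R0_one; [ring|]. intros r Hr. destruct (Nat.eqb_spec r a); [reflexivity|].
    rewrite node_diff. field. split; [lra|].
    intros E. apply n. apply INR_eq. lra.
  - intros l Hl Hne. rewrite (prod_f_R0_zero _ a m Ha); [ring|].
    destruct (Nat.eqb_spec a l); [congruence|]. unfold Rdiv. rewrite Rminus_diag. ring.
Qed.

Lemma lagr_shift (dt : R) (v : nat -> R) (m s : nat) (x : R) :
  lagr dt v m (S s) x = lagr dt (fun j => v (S j)) m s (x - dt).
Proof.
  apply sum_eq. intros l Hl. f_equal. apply prod_f_R0_ext. intros r Hr.
  destruct (Nat.eqb r l); [reflexivity|]. unfold node. simpl Nat.add. rewrite !S_INR.
  f_equal; ring.
Qed.

(** After rescaling to integer nodes this is one rational identity for each degree from 0 to 6,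
    checked separately; the bound [k <= 6] enters through this check. *)
Lemma lagr_one (dt : R) (m s : nat) (x : R) : 0 < dt -> (m <= 6)%nat ->
  lagr dt (fun _ => 1) m s x = 1.
Proof.
  intros Hdt Hm. set (y := x / dt - INR s).
  transitivity (sum_f_R0 (fun l => prod_f_R0 (fun r =>
     if Nat.eqb r l then 1 else (y - INR r) / (INR l - INR r)) m) m).
  - apply sum_eq. intros l Hl. rewrite Rmult_1_l. apply prod_f_R0_ext. intros r Hr.
    destruct (Nat.eqb_spec r l) as [|Hne]; [reflexivity|]. rewrite node_diff.
    unfold node, y. rewrite plus_INR. field.
    split; [lra|]. intros E. apply Hne, INR_eq. lra.
  - generalize y. clear - Hm. intros y.
    do 7 (destruct m as [|m]; [simpl; field|]). lia.
Qed.

(** With [pstart], the degree and leftmost node of the polynomial used on the [j]-th interval.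
    Supports and translation invariance of the three kinds of pieces become arithmetic on these two
    numbers. *)
Definition pdeg (k i j : nat) : nat := if (j <=? k - i)%nat then (k - 1)%nat else k.
Definition pstart (k i n j : nat) : nat :=
  if (j <=? k - i)%nat then O
  else if (j <=? n + 1 - i)%nat then (j + i - (k + 1))%nat else (n - k)%nat.

Lemma piece_lagr (dt : R) (v : nat -> R) (k i n j : nat) :
  (1 <= i)%nat -> (i <= k)%nat -> (j <= n)%nat ->
  piece dt v k i n j = lagr dt v (pdeg k i j) (pstart k i n j).
Proof.
  intros Hi Hk Hj. unfold piece, pdeg, pstart, interp.
  destruct (Nat.leb_spec j (k - i)).
  - apply (f_equal (lagr dt v _)). lia.
  - destruct (Nat.leb_spec j (n + 1 - i)); apply (f_equal (lagr dt v _)); lia.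
Qed.

(** * Integration against the weakly singular kernel *)

Lemma kernel_continuous (T alpha x : R) : x < T ->
  continuous (fun y => Rpower (T - y) (- alpha)) x.
Proof.
  intros H. apply (ex_derive_continuous (V := R_NormedModule)). unfold Rpower. auto_derive. lra.
Qed.

Lemma kernel_primitive (T alpha x : R) : alpha < 1 -> x < T ->
  is_derive (fun y => - Rpower (T - y) (1 - alpha) / (1 - alpha)) x (Rpower (T - x) (- alpha)).
Proof.
  intros Ha H. unfold Rpower. auto_derive; [lra|].
  replace ((1 - alpha) * ln (T + - x)) with (ln (T - x) + - alpha * ln (T - x))
    by (unfold Rminus; ring).
  rewrite exp_plus, exp_ln by lra. field. lra.
Qed.

Lemma kernel_mult_continuous (T alpha : R) (q : R -> R) (x : R) : x < T -> continuous q x ->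
  continuous (fun y => Rpower (T - y) (- alpha) * q y) x.
Proof.
  intros H Hq. apply (continuous_mult (K := R_AbsRing)); [apply kernel_continuous, H | exact Hq].
Qed.

Lemma ex_RInt_kernel (T alpha a b : R) (q : R -> R) : a <= b -> b < T ->
  (forall x, continuous q x) ->
  ex_RInt (fun y => Rpower (T - y) (- alpha) * q y) a b.
Proof.
  intros Hab Hb Hq. apply (ex_RInt_continuous (V := R_CompleteNormedModule)).
  rewrite Rmin_left, Rmax_right by exact Hab.
  intros x Hx. apply kernel_mult_continuous; [lra | apply Hq].
Qed.

(** The singularity is integrable: the bound does not depend on [v] and vanishes as [u] tends to
    [T], because [1 - alpha > 0]. *)
Lemma RInt_kernel_le (T alpha a u v M : R) (q : R -> R) :
  alpha < 1 -> a <= u -> u <= v -> v < T -> (forall x, continuous q x) ->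
  (forall x, a <= x <= T -> Rabs (q x) <= M) ->
  Rabs (RInt (fun y => Rpower (T - y) (- alpha) * q y) u v)
  <= M * (Rpower (T - u) (1 - alpha) / (1 - alpha)).
Proof.
  intros Ha Hau Huv Hv Hq HM.
  set (F := fun y => - Rpower (T - y) (1 - alpha) / (1 - alpha)).
  assert (HF : is_RInt (fun y => M * Rpower (T - y) (- alpha)) u v (M * (F v - F u))).
  { apply (is_RInt_scal (V := R_NormedModule)).
    apply (is_RInt_derive (V := R_CompleteNormedModule)); rewrite Rmin_left, Rmax_right by exact Huv;
      intros x Hx; [apply kernel_primitive | apply kernel_continuous]; lra. }
  apply Rle_trans with (M * (F v - F u)).
  - apply (norm_RInt_le (V := R_NormedModule) (fun y => Rpower (T - y) (- alpha) * q y)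
             (fun y => M * Rpower (T - y) (- alpha)) u v); [exact Huv| | |exact HF].
    + intros x Hx. change (Rabs (Rpower (T - x) (- alpha) * q x) <= M * Rpower (T - x) (- alpha)).
      assert (P : 0 < Rpower (T - x) (- alpha)) by apply exp_pos.
      rewrite Rabs_mult, (Rabs_pos_eq (Rpower _ _)) by lra.
      pose proof (HM x ltac:(lra)). nra.
    + apply (RInt_correct (V := R_CompleteNormedModule)), ex_RInt_kernel; assumption.
  - assert (M0 : 0 <= M).
    { eapply Rle_trans; [apply Rabs_pos | apply (HM a); lra]. }
    apply Rmult_le_compat_l; [exact M0|]. unfold F.
    assert (0 < Rpower (T - v) (1 - alpha) / (1 - alpha)).
    { apply Rdiv_lt_0_compat; [apply exp_pos | lra]. }
    unfold Rdiv in *. lra.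
Qed.

Lemma Rpower_small (c eps : R) : 0 < c -> 0 < eps ->
  exists d, 0 < d /\ forall y, 0 < y < d -> Rpower y c < eps.
Proof.
  intros Hc He. exists (Rpower eps (/ c)). split; [apply exp_pos|]. intros y Hy.
  replace eps with (Rpower (Rpower eps (/ c)) c).
  - apply Rlt_Rpower_l; lra.
  - rewrite Rpower_mult, Rinv_l, Rpower_1; lra.
Qed.

Lemma at_left_between (T a d : R) : a < T -> 0 < d ->
  at_left T (fun u => a < u < T /\ T - u < d).
Proof.
  intros Ha Hd. assert (P : 0 < Rmin (T - a) d) by (apply Rmin_glb_lt; lra).
  exists (mkposreal _ P). intros u Hu Hlt.
  change (Rabs (u - T) < Rmin (T - a) d) in Hu.
  pose proof (Rmin_l (T - a) d). pose proof (Rmin_r (T - a) d).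
  apply Rabs_def2 in Hu. lra.
Qed.

Lemma ex_RInt_gen_kernel (T alpha a : R) (q : R -> R) :
  alpha < 1 -> a < T -> (forall x, continuous q x) ->
  ex_RInt_gen (fun y => Rpower (T - y) (- alpha) * q y) (at_point a) (at_left T).
Proof.
  intros Halpha Ha Hq. set (f := fun y => Rpower (T - y) (- alpha) * q y).
  destruct (bounded_continuity (V := R_NormedModule) q a T) as [M HM]; [intros; apply Hq|].
  assert (HM' : forall x, a <= x <= T -> Rabs (q x) <= M).
  { intros x Hx. left. apply (HM x Hx). }
  assert (M0 : 0 <= M).
  { eapply Rle_trans; [apply Rabs_pos | apply (HM' a); lra]. }
  destruct (proj1 (filterlim_locally_cauchy (U := R_CompleteSpace) (F := at_left T)
              (fun b => RInt f a b))) as [l Hl].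
  - intros eps.
    (* Chosen so that [RInt_kernel_le] gives less than [eps] beyond [T - d]; [M + 1] guards against
       [M = 0]. *)
    destruct (Rpower_small (1 - alpha) (eps / (M + 1) * (1 - alpha))) as [d [Hd Hs]]; [lra| |].
    { apply Rmult_lt_0_compat; [|lra]. apply Rdiv_lt_0_compat; [apply cond_pos | lra]. }
    exists (fun u => a < u < T /\ T - u < d). split; [apply at_left_between; assumption|].
    assert (Sym : forall u v, a < u < T /\ T - u < d -> a < v < T -> u <= v ->
                  Rabs (RInt f a v - RInt f a u) < eps).
    { intros u v [Hu Hud] Hv Huv.
      replace (RInt f a v - RInt f a u) with (RInt f u v).
      - eapply Rle_lt_trans; [apply (RInt_kernel_le T alpha a u v M q); try assumption; lra|].
        assert (H1 : Rpower (T - u) (1 - alpha) / (1 - alpha) < eps / (M + 1)).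
        { apply Rlt_div_l; [lra|]. apply Hs. lra. }
        assert (H2 : eps / (M + 1) * (M + 1) = eps) by (field; lra).
        assert (0 < eps / (M + 1)) by (apply Rdiv_lt_0_compat; [apply cond_pos | lra]).
        assert (0 < Rpower (T - u) (1 - alpha) / (1 - alpha))
          by (apply Rdiv_lt_0_compat; [apply exp_pos | lra]).
        nra.
      - assert (Ch : RInt f a u + RInt f u v = RInt f a v).
        { apply (RInt_Chasles (V := R_CompleteNormedModule) f a u v);
            apply ex_RInt_kernel; try assumption; lra. }
        lra. }
    intros u v Hu Hv. change (Rabs (RInt f a v - RInt f a u) < eps).
    destruct (Rle_lt_dec u v) as [h|h]; [apply Sym; tauto|].
    rewrite Rabs_minus_sym. apply Sym; [exact Hv|tauto|lra].
  - exists l. intros P HP. pose proof (Hl P HP) as HQ. unfold filtermap in HQ.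
    apply (Filter_prod _ _ _ (fun u => u = a) (fun b => a < b < T /\ P (RInt f a b))).
    + reflexivity.
    + apply filter_and; [|exact HQ].
      eapply filter_imp; [|apply (at_left_between T a 1 Ha); lra]. intros u Hu; apply Hu.
    + intros u b -> [Hb Hp]. exists (RInt f a b). split; [|exact Hp].
      apply (RInt_correct (V := R_CompleteNormedModule)), ex_RInt_kernel; try assumption; simpl; lra.
Qed.

(** Only the last interval ends at the singularity of the kernel, so only there is the right end a
    one-sided limit. *)
Definition endf (dt : R) (n j : nat) : (R -> Prop) -> Prop :=
  if (j <? n)%nat then at_point (node dt j) else at_left (node dt j).

Global Instance endf_proper (dt : R) (n j : nat) : ProperFilter (endf dt n j).
Proof. unfold endf. destruct (j <? n)%nat; typeclasses eauto. Qed.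

Definition Jint (dt alpha : R) (n j : nat) (q : R -> R) : R :=
  RInt_gen (fun x => Rpower (node dt n - x) (- alpha) * q x)
           (at_point (node dt (j - 1))) (endf dt n j).

Lemma node_lt (dt : R) (i j : nat) : 0 < dt -> (i < j)%nat -> node dt i < node dt j.
Proof. intros H Hij. unfold node. apply Rmult_lt_compat_r; [exact H | apply lt_INR, Hij]. Qed.

Lemma node_le (dt : R) (i j : nat) : 0 < dt -> (i <= j)%nat -> node dt i <= node dt j.
Proof. intros H Hij. unfold node. apply Rmult_le_compat_r; [lra | apply le_INR, Hij]. Qed.

Lemma node_S (dt : R) (n : nat) : node dt (S n) = node dt n + dt.
Proof. unfold node. rewrite S_INR. ring. Qed.

Lemma is_Jint (dt alpha : R) (n j : nat) (q : R -> R) :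
  0 < dt -> alpha < 1 -> (1 <= j <= n)%nat -> (forall x, continuous q x) ->
  is_RInt_gen (fun x => Rpower (node dt n - x) (- alpha) * q x)
           (at_point (node dt (j - 1))) (endf dt n j) (Jint dt alpha n j q).
Proof.
  intros Hdt Ha Hj Hq. apply (RInt_gen_correct (V := R_CompleteNormedModule)).
  pose proof (node_lt dt (j - 1) j Hdt ltac:(lia)).
  unfold endf. destruct (Nat.ltb_spec j n) as [h|h].
  - pose proof (node_lt dt j n Hdt h).
    destruct (ex_RInt_kernel (node dt n) alpha (node dt (j - 1)) (node dt j) q) as [l Hl];
      [lra|assumption|assumption|].
    exists l. apply (is_RInt_gen_at_point (V := R_NormedModule)). exact Hl.
  - replace n with j by lia. apply ex_RInt_gen_kernel; assumption.
Qed.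

Lemma Jint_unique (dt alpha : R) (n j : nat) (q : R -> R) (l : R) :
  is_RInt_gen (fun x => Rpower (node dt n - x) (- alpha) * q x)
           (at_point (node dt (j - 1))) (endf dt n j) l -> Jint dt alpha n j q = l.
Proof. apply (is_RInt_gen_unique (V := R_CompleteNormedModule)). Qed.

Lemma Jint_ext (dt alpha : R) (n j : nat) (p q : R -> R) :
  (forall x, p x = q x) -> Jint dt alpha n j p = Jint dt alpha n j q.
Proof. intros H. f_equal. apply functional_extensionality, H. Qed.

Lemma Jint_plus (dt alpha : R) (n j : nat) (p q : R -> R) :
  0 < dt -> alpha < 1 -> (1 <= j <= n)%nat ->
  (forall x, continuous p x) -> (forall x, continuous q x) ->
  Jint dt alpha n j (fun x => p x + q x) = Jint dt alpha n j p + Jint dt alpha n j q.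
Proof.
  intros Hdt Ha Hj Hp Hq. apply Jint_unique.
  replace (fun x => Rpower (node dt n - x) (- alpha) * (p x + q x))
    with (fun x => Rpower (node dt n - x) (- alpha) * p x
                   + Rpower (node dt n - x) (- alpha) * q x)
    by (apply functional_extensionality; intros; ring).
  apply (is_RInt_gen_plus (V := R_NormedModule)); apply is_Jint; assumption.
Qed.

Lemma Jint_0 (dt alpha : R) (n j : nat) (q : R -> R) :
  0 < dt -> alpha < 1 -> (1 <= j <= n)%nat -> (forall x, q x = 0) -> Jint dt alpha n j q = 0.
Proof.
  intros Hdt Ha Hj Hq.
  (* Additivity alone gives the value: the integral equals twice itself. *)
  assert (E : forall x, q x = q x + q x) by (intros x; rewrite Hq; ring).
  assert (Cq : forall x, continuous q x).
  { intros x. apply (continuous_ext (fun _ => 0)); [intros; symmetry; apply Hq|].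
    apply continuous_const. }
  pose proof (Jint_plus dt alpha n j q q Hdt Ha Hj Cq Cq) as H.
  rewrite <- (Jint_ext dt alpha n j _ _ E) in H. lra.
Qed.

(** The kernel depends only on the distance to [t_n], so a translation by [dt] carries integrand,
    interval and end filter along. The convolution structure of the method originates here. *)
Lemma Jint_shift (dt alpha : R) (n j : nat) (q : R -> R) :
  0 < dt -> alpha < 1 -> (1 <= j <= n)%nat -> (forall x, continuous q x) ->
  Jint dt alpha (S n) (S j) (fun x => q (x - dt)) = Jint dt alpha n j q.
Proof.
  intros Hdt Ha Hj Hq. apply Jint_unique.
  pose proof (is_Jint dt alpha n j q Hdt Ha Hj Hq) as H.
  intros P HP. destruct (H P HP) as [Q1 Q2 H1 H2 H3].
  apply (Filter_prod _ _ _ (fun u => Q1 (u - dt)) (fun u => Q2 (u - dt))).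
  - unfold at_point in *. replace (node dt (S j - 1) - dt) with (node dt (j - 1)); [exact H1|].
    replace (S j - 1)%nat with (S (j - 1)) by lia. rewrite node_S. ring.
  - unfold endf in *. change (S j <? S n)%nat with (j <? n)%nat. destruct (j <? n)%nat.
    + unfold at_point in *. rewrite node_S. replace (node dt j + dt - dt) with (node dt j) by ring.
      exact H2.
    + destruct H2 as [eps He]. exists eps. intros y Hy Hlt. rewrite node_S in *.
      apply He; [|lra].
      change (Rabs (y - dt - node dt j) < eps). change (Rabs (y - (node dt j + dt)) < eps) in Hy.
      replace (y - dt - node dt j) with (y - (node dt j + dt)) by ring. exact Hy.
  - intros u v Hu Hv. destruct (H3 _ _ Hu Hv) as [y [Hy Py]]. exists y. split; [|exact Py].
    simpl in *.
    assert (G := is_RInt_comp_lin (V := R_NormedModule)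
                   (fun x => Rpower (node dt n - x) (- alpha) * q x) 1 (- dt) u v y).
    replace (1 * u + - dt) with (u - dt) in G by ring.
    replace (1 * v + - dt) with (v - dt) in G by ring.
    specialize (G Hy). eapply is_RInt_ext; [|exact G].
    intros x _. rewrite node_S.
    change (1 * (Rpower (node dt n - (1 * x + - dt)) (- alpha) * q (1 * x + - dt))
            = Rpower (node dt n + dt - x) (- alpha) * q (x - dt)).
    replace (1 * x + - dt) with (x - dt) by ring.
    replace (node dt n - (x - dt)) with (node dt n + dt - x) by ring. ring.
Qed.

Lemma Pk_interior (dt : R) (v : nat -> R) (k i n j : nat) (x : R) :
  0 < dt -> (1 <= j <= n)%nat -> node dt (j - 1) < x < node dt j ->
  Pk dt v k i n x = piece dt v k i n j x.
Proof.
  intros Hdt Hj Hx. unfold Pk.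
  assert (E : up (x / dt) = Z.of_nat j).
  { symmetry. apply tech_up; rewrite <- INR_IZR_INZ.
    - apply Rlt_div_l; [exact Hdt | apply Hx].
    - apply Rmult_le_reg_r with dt; [exact Hdt|].
      assert (N : node dt j = node dt (j - 1) + dt)
        by (replace j with (S (j - 1)) at 1 by lia; apply node_S).
      unfold node in *. field_simplify; lra. }
  rewrite E, Nat2Z.id, Nat.min_r by lia. reflexivity.
Qed.

Lemma Derive_Pk (dt : R) (v : nat -> R) (k i n j : nat) (x : R) :
  0 < dt -> (1 <= j <= n)%nat -> node dt (j - 1) < x < node dt j ->
  Derive (Pk dt v k i n) x = Derive (piece dt v k i n j) x.
Proof.
  intros Hdt Hj Hx. apply Derive_ext_loc.
  assert (P : 0 < Rmin (x - node dt (j - 1)) (node dt j - x)) by (apply Rmin_glb_lt; lra).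
  exists (mkposreal _ P). intros y Hy.
  change (Rabs (y - x) < Rmin (x - node dt (j - 1)) (node dt j - x)) in Hy.
  pose proof (Rmin_l (x - node dt (j - 1)) (node dt j - x)).
  pose proof (Rmin_r (x - node dt (j - 1)) (node dt j - x)).
  apply Rabs_def2 in Hy. apply Pk_interior; try assumption. lra.
Qed.

(** Equality of integrands is required on the open interval only, so the value of [Derive] at a
    node, where two pieces may meet with different slopes, is immaterial. *)
Lemma is_RInt_gen_Pk_piece (dt alpha : R) (v : nat -> R) (k i n j : nat) :
  0 < dt -> alpha < 1 -> (1 <= i)%nat -> (i <= k)%nat -> (1 <= j <= n)%nat ->
  is_RInt_gen (fun x => Rpower (node dt n - x) (- alpha) * Derive (Pk dt v k i n) x)
    (at_point (node dt (j - 1))) (endf dt n j)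
    (Jint dt alpha n j (Derive (piece dt v k i n j))).
Proof.
  intros Hdt Ha Hi Hk Hj.
  apply (is_RInt_gen_ext (V := R_NormedModule)
          (fun x => Rpower (node dt n - x) (- alpha) * Derive (piece dt v k i n j) x)).
  - pose proof (node_lt dt (j - 1) j Hdt ltac:(lia)) as L.
    apply (Filter_prod _ _ _ (fun u => u = node dt (j - 1))
             (fun b => node dt (j - 1) < b <= node dt j)).
    + reflexivity.
    + unfold endf. destruct (j <? n)%nat; [unfold at_point; lra|].
      eapply filter_imp; [|apply (at_left_between _ _ 1 L); lra]. simpl. intros; lra.
    + intros u b -> Hb x. simpl. rewrite Rmin_left, Rmax_right by lra. intros Hx.
      rewrite (Derive_Pk dt v k i n j) by (try assumption; lra). reflexivity.
  - apply is_Jint; try assumption. rewrite piece_lagr by (try assumption; lia). apply lagr_cont_diff.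
Qed.

Lemma Dalpha_rsum (dt alpha : R) (v : nat -> R) (k i n : nat) :
  0 < dt -> alpha < 1 -> (1 <= i)%nat -> (i <= k)%nat -> (1 <= n)%nat ->
  Dalpha dt alpha k i v n
  = / Gamma (1 - alpha)
    * rsum (fun j => Jint dt alpha n (S j) (Derive (piece dt v k i n (S j)))) n.
Proof.
  intros Hdt Ha Hi Hk Hn. unfold Dalpha. f_equal.
  apply (is_RInt_gen_unique (V := R_CompleteNormedModule)).
  set (f := fun xi => Rpower (node dt n - xi) (- alpha) * Derive (Pk dt v k i n) xi).
  assert (Pre : forall m, (m < n)%nat ->
    is_RInt_gen f (at_point 0) (at_point (node dt m))
      (rsum (fun j => Jint dt alpha n (S j) (Derive (piece dt v k i n (S j)))) m)).
  { induction m as [|m IH]; intros Hm.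
    - replace (node dt 0) with 0 by (unfold node; simpl; ring).
      apply (is_RInt_gen_point (V := R_NormedModule)).
    - simpl. apply (is_RInt_gen_Chasles (V := R_NormedModule) f (node dt m)); [apply IH; lia|].
      pose proof (is_RInt_gen_Pk_piece dt alpha v k i n (S m) Hdt Ha Hi Hk ltac:(lia)) as H.
      replace (S m - 1)%nat with m in H by lia. unfold endf in H.
      replace (S m <? n)%nat with true in H by (symmetry; apply Nat.ltb_lt, Hm). exact H. }
  destruct n as [|n]; [lia|]. simpl rsum.
  apply (is_RInt_gen_Chasles (V := R_NormedModule) f (node dt n)); [apply Pre; lia|].
  pose proof (is_RInt_gen_Pk_piece dt alpha v k i (S n) (S n) Hdt Ha Hi Hk ltac:(lia)) as H.
  replace (S n - 1)%nat with n in H by lia. unfold endf in H.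
  rewrite Nat.ltb_irrefl in H. exact H.
Qed.

(** * The coefficients of the method *)

Definition unitv (q : nat) : nat -> R := fun m => if Nat.eqb m q then 1 else 0.

Lemma unitv_neq (m q : nat) : m <> q -> unitv q m = 0.
Proof. intros H. unfold unitv. apply Nat.eqb_neq in H. rewrite H. reflexivity. Qed.

(** Contribution of the [j]-th interval to the coefficient of [u_q], up to the factor
    [dt^alpha / Gamma (1 - alpha)]. *)
Definition jterm (dt alpha : R) (k i n q j : nat) : R :=
  Jint dt alpha n j (Derive (piece dt (unitv q) k i n j)).

Lemma coef_rsum (dt alpha : R) (k i n q : nat) :
  0 < dt -> alpha < 1 -> (1 <= i)%nat -> (i <= k)%nat -> (1 <= n)%nat ->
  coef dt alpha k i n q
  = Rpower dt alpha * / Gamma (1 - alpha) * rsum (fun j => jterm dt alpha k i n q (S j)) n.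
Proof.
  intros Hdt Ha Hi Hk Hn. unfold coef.
  change (fun m => if Nat.eqb m q then 1 else 0) with (unitv q).
  rewrite Dalpha_rsum by assumption. unfold jterm. ring.
Qed.

Lemma piece_cont_diff (dt : R) (v : nat -> R) (k i n j : nat) :
  (1 <= i)%nat -> (i <= k)%nat -> (j <= n)%nat -> cont_diff (piece dt v k i n j).
Proof. intros. rewrite piece_lagr by assumption. apply lagr_cont_diff. Qed.

Lemma piece_range (k i n j : nat) : (1 <= i)%nat -> (i <= k)%nat -> (k <= n)%nat ->
  (j <= n)%nat -> (pstart k i n j + pdeg k i j <= n)%nat.
Proof.
  intros. unfold pstart, pdeg. destruct (Nat.leb_spec j (k - i)); [lia|].
  destruct (Nat.leb_spec j (n + 1 - i)); lia.
Qed.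

Lemma Derive_zero (f : R -> R) (c : R) : (forall x, f x = c) -> forall x, Derive f x = 0.
Proof.
  intros H x. rewrite (Derive_ext f (fun _ => c)) by exact H. apply Derive_const.
Qed.

Lemma jterm_zero (dt alpha : R) (k i n q j : nat) :
  0 < dt -> alpha < 1 -> (1 <= i)%nat -> (i <= k)%nat -> (1 <= j <= n)%nat ->
  (q < pstart k i n j \/ pstart k i n j + pdeg k i j < q)%nat ->
  jterm dt alpha k i n q j = 0.
Proof.
  intros Hdt Ha Hi Hk Hj Hq. apply Jint_0; try assumption.
  apply (Derive_zero _ 0). intros x. rewrite piece_lagr by (try assumption; lia).
  apply lagr_0. intros l Hl. apply unitv_neq. lia.
Qed.

Lemma jterm_sum (dt alpha : R) (k i n j Q : nat) :
  0 < dt -> alpha < 1 -> (1 <= i)%nat -> (i <= k)%nat -> (1 <= j <= n)%nat ->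
  rsum (fun q => jterm dt alpha k i n q j) Q
  = Jint dt alpha n j (Derive (piece dt (fun m => if (m <? Q)%nat then 1 else 0) k i n j)).
Proof.
  intros Hdt Ha Hi Hk Hj. induction Q as [|Q IH].
  - simpl. symmetry. apply Jint_0; try assumption. apply (Derive_zero _ 0). intros x.
    rewrite piece_lagr by (try assumption; lia). apply lagr_0. reflexivity.
  - simpl. rewrite IH. unfold jterm. rewrite <- Jint_plus; try assumption;
      try (apply piece_cont_diff; try assumption; lia).
    apply Jint_ext. intros x. rewrite <- Derive_plus by (apply piece_cont_diff; try assumption; lia).
    apply Derive_ext. intros y. rewrite !piece_lagr by (try assumption; lia).
    rewrite <- lagr_plus. apply lagr_ext. intros l Hl.
    unfold unitv. destruct (Nat.ltb_spec (pstart k i n j + l) Q);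
    destruct (Nat.ltb_spec (pstart k i n j + l) (S Q));
    destruct (Nat.eqb_spec (pstart k i n j + l) Q); try lia; ring.
Qed.

(** Interpolation reproduces constants, so every piece has zero derivative. By [piece_range] no
    piece looks beyond [t_n], hence the truncated unit sequence acts as the constant one. *)
Lemma coef_sum_zero (dt alpha : R) (k i n : nat) :
  0 < dt -> alpha < 1 -> (1 <= i)%nat -> (i <= k)%nat -> (k <= 6)%nat -> (k <= n)%nat ->
  rsum (coef dt alpha k i n) (S n) = 0.
Proof.
  intros Hdt Ha Hi Hk H6 Hn.
  rewrite (rsum_ext _ (fun q => Rpower dt alpha * / Gamma (1 - alpha)
             * rsum (fun j => jterm dt alpha k i n q (S j)) n))
    by (intros; apply coef_rsum; try assumption; lia).
  rewrite rsum_scal, rsum_swap, rsum_0; [ring|]. intros j Hj.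
  rewrite jterm_sum by (try assumption; lia). apply Jint_0; try assumption; [lia|].
  apply (Derive_zero _ 1). intros x. rewrite piece_lagr by (try assumption; lia).
  transitivity (lagr dt (fun _ => 1) (pdeg k i (S j)) (pstart k i n (S j)) x).
  - apply lagr_ext. intros l Hl. pose proof (piece_range k i n (S j) Hi Hk Hn ltac:(lia)).
    destruct (Nat.ltb_spec (pstart k i n (S j) + l) (S n)); [reflexivity|lia].
  - apply lagr_one; [exact Hdt|]. unfold pdeg. destruct (S j <=? k - i)%nat; lia.
Qed.

Lemma jterm_shift (dt alpha : R) (k i n q j : nat) :
  0 < dt -> alpha < 1 -> (1 <= i)%nat -> (i <= k)%nat -> (k <= n)%nat -> (k <= q)%nat ->
  (1 <= j <= n)%nat ->
  jterm dt alpha k i (S n) (S q) (S j) = jterm dt alpha k i n q j.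
Proof.
  (* The pieces near the origin are not translates of each other, but they see only nodes up to
     [k - 1], or up to [k] after the shift, below [q] and [S q] respectively. Both terms vanish
     there. *)
  intros Hdt Ha Hi Hk Hn Hq Hj. destruct (le_lt_dec j (k - i)) as [h|h].
  - rewrite !jterm_zero; try assumption; try lia; [reflexivity| |].
    + unfold pstart, pdeg. destruct (Nat.leb_spec j (k - i)); lia.
    + unfold pstart, pdeg. destruct (Nat.leb_spec (S j) (k - i)); [lia|].
      destruct (Nat.leb_spec (S j) (S n + 1 - i)); lia.
  - unfold jterm. rewrite <- (Jint_shift dt alpha n j); try assumption.
    + apply Jint_ext. intros x.
      assert (E : forall y, piece dt (unitv (S q)) k i (S n) (S j) y
                  = piece dt (unitv q) k i n j (y - dt)).
      { intros y. rewrite !piece_lagr by (try assumption; lia).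
        assert (E1 : pdeg k i (S j) = pdeg k i j).
        { unfold pdeg. destruct (Nat.leb_spec (S j) (k - i)); destruct (Nat.leb_spec j (k - i)); lia. }
        assert (E2 : pstart k i (S n) (S j) = S (pstart k i n j)).
        { unfold pstart. destruct (Nat.leb_spec (S j) (k - i)); [lia|].
          destruct (Nat.leb_spec j (k - i)); [lia|].
          destruct (Nat.leb_spec (S j) (S n + 1 - i)); destruct (Nat.leb_spec j (n + 1 - i)); lia. }
        rewrite E1, E2, lagr_shift. reflexivity. }
      rewrite (Derive_ext _ _ x E).
      rewrite (Derive_comp (piece dt (unitv q) k i n j) (fun y => y - dt)).
      * replace (Derive (fun y => y - dt) x) with 1; [ring|].
        symmetry. apply is_derive_unique. auto_derive; [trivial|ring].
      * apply piece_cont_diff; try assumption; lia.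
      * auto_derive. trivial.
    + apply piece_cont_diff; try assumption; lia.
Qed.

Lemma coef_shift (dt alpha : R) (k i n q : nat) :
  0 < dt -> alpha < 1 -> (1 <= i)%nat -> (i <= k)%nat -> (k <= n)%nat -> (k <= q)%nat ->
  coef dt alpha k i (S n) (S q) = coef dt alpha k i n q.
Proof.
  intros Hdt Ha Hi Hk Hn Hq. rewrite !coef_rsum by (try assumption; lia).
  rewrite rsum_S_l, jterm_zero; try assumption; try lia.
  - rewrite Rplus_0_l. f_equal. apply rsum_ext. intros j Hj. apply jterm_shift; try assumption; lia.
  - unfold pstart, pdeg. destruct (Nat.leb_spec 1 (k - i)); [lia|].
    destruct (Nat.leb_spec 1 (S n + 1 - i)); lia.
Qed.

(** Justifies [omega], which samples column [k] only: from that column on, a coefficient depends on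
    [n - q] alone. *)
Lemma coef_omega (dt alpha : R) (k i n q : nat) :
  0 < dt -> alpha < 1 -> (1 <= i)%nat -> (i <= k)%nat -> (k <= q)%nat -> (q <= n)%nat ->
  coef dt alpha k i n q = omega dt alpha k i (n - q).
Proof.
  intros Hdt Ha Hi Hk Hq Hn. unfold omega.
  assert (G : forall d, coef dt alpha k i (n - q + k + d) (k + d) = coef dt alpha k i (n - q + k) k).
  { induction d as [|d IH]; [rewrite !Nat.add_0_r; reflexivity|].
    rewrite !Nat.add_succ_r, coef_shift by (try assumption; lia). exact IH. }
  rewrite <- (G (q - k)%nat). f_equal; lia.
Qed.

(** For [n >= 3 k + 1] the first [2 k + 1] intervals avoid the modified pieces at the right end, so
    the derivative there does not depend on [n]; [3 k + 1] is a fixed representative. *)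
Definition theta (dt : R) (k i q j : nat) : R -> R :=
  Derive (piece dt (unitv q) k i (3 * k + 1) (S j)).

Lemma theta_continuous (dt : R) (k i q j : nat) (x : R) :
  (1 <= i)%nat -> (i <= k)%nat -> (j < 2 * k + 1)%nat -> continuous (theta dt k i q j) x.
Proof. intros. apply piece_cont_diff; try assumption; lia. Qed.

(** Past the first [2 k + 1] intervals all interpolation nodes exceed [k >= q]. What remains stays
    away from the singularity and is an ordinary integral against a fixed function. *)
Lemma coef_far (dt alpha : R) (k i n q : nat) :
  0 < dt -> alpha < 1 -> (1 <= i)%nat -> (i <= k)%nat -> (q <= k)%nat -> (3 * k + 1 <= n)%nat ->
  coef dt alpha k i n q
  = Rpower dt alpha * / Gamma (1 - alpha)
    * rsum (fun j => RInt (fun x => Rpower (node dt n - x) (- alpha) * theta dt k i q j x)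
                          (node dt j) (node dt (S j))) (2 * k + 1).
Proof.
  intros Hdt Ha Hi Hk Hq Hn. rewrite coef_rsum by (try assumption; lia). f_equal.
  rewrite (rsum_trunc _ (2 * k + 1)) by
    (try lia; intros j Hj; apply jterm_zero; try assumption; try lia;
     unfold pstart, pdeg; destruct (Nat.leb_spec (S j) (k - i)); try lia;
     destruct (Nat.leb_spec (S j) (n + 1 - i)); lia).
  apply rsum_ext. intros j Hj. unfold jterm.
  rewrite (Jint_ext _ _ _ _ _ (theta dt k i q j)).
  - unfold Jint, endf. replace (S j - 1)%nat with j by lia.
    replace (S j <? n)%nat with true by (symmetry; apply Nat.ltb_lt; lia).
    apply (RInt_gen_at_point (V := R_CompleteNormedModule)). apply ex_RInt_kernel.
    + apply node_le; [assumption|lia].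
    + apply node_lt; [assumption|lia].
    + intros x. apply theta_continuous; assumption.
  - intros x. unfold theta. apply Derive_ext. intros y.
    rewrite !piece_lagr by (try assumption; lia).
    replace (pstart k i (3 * k + 1) (S j)) with (pstart k i n (S j)); [reflexivity|].
    unfold pstart. destruct (Nat.leb_spec (S j) (k - i)); [reflexivity|].
    destruct (Nat.leb_spec (S j) (n + 1 - i)); destruct (Nat.leb_spec (S j) (3 * k + 1 + 1 - i)); lia.
Qed.

(** Each piece interpolates at both ends of its own interval, so the fundamental theorem of calculus
    gives grid values. *)
Lemma RInt_theta (dt : R) (k i q j : nat) :
  0 < dt -> (1 <= i)%nat -> (i <= k)%nat -> (j < 2 * k + 1)%nat ->
  RInt (theta dt k i q j) (node dt j) (node dt (S j)) = unitv q (S j) - unitv q j.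
Proof.
  intros Hdt Hi Hk Hj. unfold theta.
  rewrite RInt_Derive by (intros; apply piece_cont_diff; try assumption; lia).
  rewrite piece_lagr by (try assumption; lia).
  assert (R1 : exists a, (a <= pdeg k i (S j))%nat /\ j = (pstart k i (3 * k + 1) (S j) + a)%nat).
  { exists (j - pstart k i (3 * k + 1) (S j))%nat. unfold pstart, pdeg.
    destruct (Nat.leb_spec (S j) (k - i)); [lia|].
    destruct (Nat.leb_spec (S j) (3 * k + 1 + 1 - i)); lia. }
  assert (R2 : exists a, (a <= pdeg k i (S j))%nat /\ S j = (pstart k i (3 * k + 1) (S j) + a)%nat).
  { exists (S j - pstart k i (3 * k + 1) (S j))%nat. unfold pstart, pdeg.
    destruct (Nat.leb_spec (S j) (k - i)); [lia|].
    destruct (Nat.leb_spec (S j) (3 * k + 1 + 1 - i)); lia. }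
  set (d := pdeg k i (S j)) in *. set (s := pstart k i (3 * k + 1) (S j)) in *.
  destruct R1 as [a [Ha Ea]], R2 as [b [Hb Eb]].
  clearbody d s. rewrite Eb, Ea at 1. rewrite !lagr_node by assumption.
  rewrite <- Ea, <- Eb. reflexivity.
Qed.

(** The increments telescope, and the unit vector at [k] vanishes at both [0] and [2 k + 1]. This
    mean zero gains one power of decay over the kernel. *)
Lemma RInt_theta_total (dt : R) (k i : nat) :
  0 < dt -> (1 <= i)%nat -> (i <= k)%nat ->
  rsum (fun j => RInt (theta dt k i k j) (node dt j) (node dt (S j))) (2 * k + 1) = 0.
Proof.
  intros Hdt Hi Hk.
  rewrite (rsum_ext _ (fun j => unitv k (S j) - unitv k j))
    by (intros; apply RInt_theta; assumption).
  assert (T : forall m, rsum (fun j => unitv k (S j) - unitv k j) m = unitv k m - unitv k 0).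
  { induction m as [|m IH]; simpl; [ring | rewrite IH; ring]. }
  rewrite T, !unitv_neq by lia. ring.
Qed.

(** [M] is the integral of the modulus of [theta]. The constant [c] is free: [0] for mere
    convergence of coefficients, the value of the kernel at the origin when the mean is zero. *)
Lemma theta_osc (dt : R) (k i q : nat) :
  0 < dt -> (1 <= i)%nat -> (i <= k)%nat ->
  exists M, 0 <= M /\ forall (kap : R -> R) (c osc : R),
    (forall x, 0 <= x <= node dt (2 * k + 1) -> continuous kap x) ->
    (forall x, 0 <= x <= node dt (2 * k + 1) -> Rabs (kap x - c) <= osc) ->
    Rabs (rsum (fun j => RInt (fun x => kap x * theta dt k i q j x) (node dt j) (node dt (S j)))
            (2 * k + 1)
          - c * rsum (fun j => RInt (theta dt k i q j) (node dt j) (node dt (S j))) (2 * k + 1))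
    <= osc * M.
Proof.
  intros Hdt Hi Hk.
  assert (Cth : forall j x, (j < 2 * k + 1)%nat -> continuous (theta dt k i q j) x)
    by (intros; apply theta_continuous; assumption).
  assert (CA : forall j x, (j < 2 * k + 1)%nat -> continuous (fun y => Rabs (theta dt k i q j y)) x).
  { intros j x Hj. apply (continuous_comp (theta dt k i q j) Rabs); [apply Cth, Hj|].
    apply continuous_Rabs. }
  exists (rsum (fun j => RInt (fun x => Rabs (theta dt k i q j x)) (node dt j) (node dt (S j)))
            (2 * k + 1)). split.
  - rewrite <- (rsum_0 (fun _ => 0) (2 * k + 1)) by reflexivity.
    apply rsum_le. intros j Hj. pose proof (node_lt dt j (S j) Hdt ltac:(lia)).
    apply RInt_ge_0; [lra| |intros; apply Rabs_pos].
    apply (ex_RInt_continuous (V := R_CompleteNormedModule)). intros; apply CA, Hj.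
  - intros kap c osc Hc Ho.
    rewrite <- rsum_scal. unfold Rminus.
    replace (- rsum (fun j => c * RInt (theta dt k i q j) (node dt j) (node dt (S j))) (2 * k + 1))
      with (rsum (fun j => -1 * (c * RInt (theta dt k i q j) (node dt j) (node dt (S j)))) (2 * k + 1))
      by (rewrite rsum_scal; ring).
    rewrite <- rsum_plus, <- rsum_scal.
    eapply Rle_trans; [apply rsum_abs|]. apply rsum_le. intros j Hj.
    pose proof (node_lt dt j (S j) Hdt ltac:(lia)) as L.
    pose proof (node_le dt 0 j Hdt ltac:(lia)) as L0.
    pose proof (node_le dt (S j) (2 * k + 1) Hdt ltac:(lia)) as L1.
    replace (node dt 0) with 0 in L0 by (unfold node; simpl; ring).
    assert (I1 : is_RInt (fun x => kap x * theta dt k i q j x) (node dt j) (node dt (S j))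
                   (RInt (fun x => kap x * theta dt k i q j x) (node dt j) (node dt (S j)))).
    { apply (RInt_correct (V := R_CompleteNormedModule)),
        (ex_RInt_continuous (V := R_CompleteNormedModule)).
      rewrite Rmin_left, Rmax_right by lra. intros x Hx.
      apply (continuous_mult (K := R_AbsRing)); [apply Hc; lra | apply Cth, Hj]. }
    assert (I2 : is_RInt (theta dt k i q j) (node dt j) (node dt (S j))
                   (RInt (theta dt k i q j) (node dt j) (node dt (S j)))).
    { apply (RInt_correct (V := R_CompleteNormedModule)),
        (ex_RInt_continuous (V := R_CompleteNormedModule)). intros; apply Cth, Hj. }
    assert (I3 : is_RInt (fun x => Rabs (theta dt k i q j x)) (node dt j) (node dt (S j))
                   (RInt (fun x => Rabs (theta dt k i q j x)) (node dt j) (node dt (S j)))).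
    { apply (RInt_correct (V := R_CompleteNormedModule)),
        (ex_RInt_continuous (V := R_CompleteNormedModule)). intros; apply CA, Hj. }
    pose proof (is_RInt_scal (V := R_NormedModule) _ _ _ (- c) _ I2) as I2'.
    pose proof (is_RInt_plus (V := R_NormedModule) _ _ _ _ _ _ I1 I2') as I4.
    pose proof (is_RInt_scal (V := R_NormedModule) _ _ _ osc _ I3) as I3'.
    replace (-1 * (c * RInt (theta dt k i q j) (node dt j) (node dt (S j))))
      with (- c * RInt (theta dt k i q j) (node dt j) (node dt (S j))) by ring.
    apply (norm_RInt_le (V := R_NormedModule) _ _ _ _ _ _ (Rlt_le _ _ L)) with (2 := I4) (3 := I3').
    intros x Hx.
    change (Rabs (kap x * theta dt k i q j x + - c * theta dt k i q j x)
            <= osc * Rabs (theta dt k i q j x)).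
    replace (kap x * theta dt k i q j x + - c * theta dt k i q j x)
      with ((kap x - c) * theta dt k i q j x) by ring.
    rewrite Rabs_mult. apply Rmult_le_compat_r; [apply Rabs_pos|]. apply Ho. lra.
Qed.

(** * Decay of the weights *)

(** A difference over [p] steps is a sum of [p] consecutive ones, each family telescoping to at most
    [B 0]. *)
Lemma rsum_telescope_le (B : nat -> R) (p N : nat) :
  (forall l, 0 <= B l) -> (forall l, B (S l) <= B l) ->
  rsum (fun l => B l - B (l + p)%nat) N <= INR p * B O.
Proof.
  intros H0 Hd.
  assert (Mono : forall l, B l <= B O).
  { induction l as [|l IH]; [lra | pose proof (Hd l); lra]. }
  induction p as [|p IH].
  - rewrite rsum_0; [simpl; lra|]. intros l _. rewrite Nat.add_0_r. ring.
  - rewrite (rsum_ext _ (fun l => (B l - B (l + p)%nat) + (B (l + p)%nat - B (S l + p)%nat)))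
      by (intros l _; rewrite Nat.add_succ_r; simpl; ring).
    rewrite rsum_plus, S_INR.
    assert (T : rsum (fun l => B (l + p)%nat - B (S l + p)%nat) N = B p - B (N + p)%nat).
    { clear. induction N as [|N IH]; cbn [rsum]; [simpl; ring | rewrite IH; simpl; ring]. }
    rewrite T. pose proof (Mono p). pose proof (H0 (N + p)%nat). lra.
Qed.

Lemma Rpower_neg_decr (a x y : R) : 0 < a -> 0 < x -> x <= y ->
  Rpower y (- a) <= Rpower x (- a).
Proof.
  intros Ha Hx Hxy. rewrite !Rpower_Ropp. apply Rinv_le_contravar; [apply exp_pos|].
  apply Rle_Rpower_l; lra.
Qed.

Lemma Rpower_neg_small (a eps : R) : 0 < a -> 0 < eps ->
  exists Y, forall y, 0 < y -> Y < y -> Rpower y (- a) < eps.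
Proof.
  intros Ha He. exists (Rpower (/ eps) (/ a)). intros y Hy HY.
  rewrite Rpower_Ropp, <- (Rinv_inv eps). apply Rinv_lt_contravar.
  - apply Rmult_lt_0_compat; [apply Rinv_0_lt_compat, He | apply exp_pos].
  - replace (/ eps) with (Rpower (Rpower (/ eps) (/ a)) a).
    + apply Rlt_Rpower_l; [exact Ha|]. split; [apply exp_pos | exact HY].
    + rewrite Rpower_mult, Rinv_l, Rpower_1; [reflexivity|apply Rinv_0_lt_compat, He|lra].
Qed.

(** Convexity of the power function: its derivative is increasing, so its drops over a fixed step
    [h] shrink. *)
Lemma Rpower_neg_diff_decr (a h x y : R) : 0 < a -> 0 < h -> 0 < x -> x <= y ->
  Rpower y (- a) - Rpower (y + h) (- a) <= Rpower x (- a) - Rpower (x + h) (- a).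
Proof.
  intros Ha Hh Hx Hxy.
  set (g := fun s => Rpower s (- a) - Rpower (s + h) (- a)).
  set (dg := fun s => - a * Rpower s (- a - 1) - - a * Rpower (s + h) (- a - 1)).
  destruct (MVT_gen g x y dg) as [c [Hc E]].
  - rewrite Rmin_left, Rmax_right by exact Hxy. intros s Hs. unfold g, dg.
    apply (is_derive_minus (V := R_NormedModule)).
    + apply is_derive_Reals, derivable_pt_lim_power. lra.
    + replace (- a * Rpower (s + h) (- a - 1)) with (1 * (- a * Rpower (s + h) (- a - 1))) by ring.
      apply (is_derive_comp (V := R_NormedModule) (fun s => Rpower s (- a)) (fun s => s + h)).
      * apply is_derive_Reals, (derivable_pt_lim_power (s + h) (- a)). lra.
      * auto_derive; [trivial|ring].
  - rewrite Rmin_left, Rmax_right by exact Hxy. intros s Hs.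
    apply continuity_pt_filterlim.
    apply (ex_derive_continuous (V := R_NormedModule) g). unfold g, Rpower. auto_derive. lra.
  - rewrite Rmin_left, Rmax_right in Hc by exact Hxy.
    assert (K : dg c <= 0).
    { unfold dg. replace (- a - 1) with (- (a + 1)) by ring.
      pose proof (Rpower_neg_decr (a + 1) c (c + h) ltac:(lra) ltac:(lra) ltac:(lra)). nra. }
    change (g y <= g x). nra.
Qed.

Section Decay.

Variables (dt alpha : R) (k i : nat).
Hypotheses (Hdt : 0 < dt) (Halpha : 0 < alpha < 1) (Hi : (1 <= i)%nat) (Hk : (i <= k)%nat).

(** For the weight of index [2 k + 2 + l], [bnd l] and [bnd (l + (2 * k + 1))] are the largest and
    smallest values of the kernel on the support of [theta], taken at its right and left ends. *)
Let bnd (l : nat) : R := Rpower (node dt (k + 1 + l)) (- alpha).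

Let node_pos (l : nat) : 0 < node dt (k + 1 + l).
Proof.
  pose proof (node_lt dt 0 (k + 1 + l) Hdt ltac:(lia)) as H.
  unfold node at 1 in H. simpl in H. lra.
Qed.

Let bnd_pos (l : nat) : 0 <= bnd l.
Proof. left. apply exp_pos. Qed.

Let bnd_decr (l : nat) : bnd (S l) <= bnd l.
Proof.
  apply Rpower_neg_decr; [lra | apply node_pos | apply node_le; [exact Hdt|lia]].
Qed.

Let bnd_conv (l : nat) : bnd (S l) - bnd (S (S l)) <= bnd l - bnd (S l).
Proof.
  unfold bnd. replace (k + 1 + S (S l))%nat with (S (S (k + 1 + l))) by lia.
  replace (k + 1 + S l)%nat with (S (k + 1 + l)) by lia. rewrite !node_S.
  apply Rpower_neg_diff_decr; try lra. apply node_pos.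
Qed.

Lemma coef_limit (q : nat) (eps : R) : (q <= k)%nat -> 0 < eps ->
  exists N, forall n, (N <= n)%nat -> Rabs (coef dt alpha k i n q) < eps.
Proof.
  intros Hq Heps. destruct (theta_osc dt k i q Hdt Hi Hk) as [M [M0 HM]].
  set (cst := Rpower dt alpha * / Gamma (1 - alpha)).
  pose proof (Rabs_pos cst) as C0.
  assert (E0 : 0 < eps / ((Rabs cst + 1) * (M + 1))) by (apply Rdiv_lt_0_compat; nra).
  destruct (Rpower_neg_small alpha (eps / ((Rabs cst + 1) * (M + 1)))) as [Y HY]; [lra|exact E0|].
  destruct (nfloor_ex (Rmax 0 (Y / dt))) as [N0 [_ HN0]]; [apply Rmax_l|].
  exists (N0 + 3 * k + 3)%nat. intros n Hn.
  rewrite coef_far by (try assumption; try lia; lra). fold cst.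
  set (z := node dt n - node dt (2 * k + 1)).
  assert (Hz : 0 < z /\ Y < z).
  { unfold z. replace n with (2 * k + 1 + (n - 2 * k - 1))%nat by lia.
    unfold node. rewrite plus_INR, Rmult_plus_distr_r.
    assert (H1 : INR N0 + 1 <= INR (n - 2 * k - 1)) by (rewrite <- S_INR; apply le_INR; lia).
    pose proof (pos_INR N0). pose proof (Rmax_r 0 (Y / dt)).
    assert (H2 : Y / dt < INR (n - 2 * k - 1)) by lra.
    apply Rlt_div_l in H2; [|exact Hdt].
    split; [|lra]. assert (0 < INR (n - 2 * k - 1) * dt) by (apply Rmult_lt_0_compat; lra). lra. }
  assert (B := HM (fun x => Rpower (node dt n - x) (- alpha)) 0 (Rpower z (- alpha))).
  rewrite Rmult_0_l, Rminus_0_r in B.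
  assert (B' : Rabs (rsum (fun j => RInt (fun x => Rpower (node dt n - x) (- alpha)
                       * theta dt k i q j x) (node dt j) (node dt (S j))) (2 * k + 1))
               <= Rpower z (- alpha) * M).
  { apply B.
    - intros x Hx. apply kernel_continuous. unfold z in Hz. lra.
    - intros x Hx. rewrite Rminus_0_r, Rabs_pos_eq by (left; apply exp_pos).
      apply Rpower_neg_decr; unfold z in *; lra. }
  rewrite Rabs_mult. pose proof (HY z (proj1 Hz) (proj2 Hz)) as H3.
  assert (Zp : 0 < Rpower z (- alpha)) by apply exp_pos.
  assert (H4 : eps / ((Rabs cst + 1) * (M + 1)) * ((Rabs cst + 1) * (M + 1)) = eps)
    by (field; split; lra).
  apply Rle_lt_trans with (Rabs cst * (Rpower z (- alpha) * M)).
  - apply Rmult_le_compat_l; assumption.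
  - apply Rle_lt_trans with (Rpower z (- alpha) * ((Rabs cst + 1) * (M + 1))).
    + replace (Rabs cst * (Rpower z (- alpha) * M)) with (Rpower z (- alpha) * (Rabs cst * M)) by ring.
      apply Rmult_le_compat_l; nra.
    + rewrite <- H4. apply Rmult_lt_compat_r; [nra | exact H3].
Qed.

Let far (l : nat) : node dt (2 * k + 2 + l + k) - node dt (2 * k + 1) = node dt (k + 1 + l).
Proof.
  replace (2 * k + 2 + l + k)%nat with (2 * k + 1 + (k + 1 + l))%nat by lia.
  unfold node. rewrite (plus_INR (2 * k + 1)). ring.
Qed.

Let omega_far (l : nat) :
  omega dt alpha k i (2 * k + 2 + l)
  = Rpower dt alpha * / Gamma (1 - alpha)
    * rsum (fun j => RInt (fun x => Rpower (node dt (2 * k + 2 + l + k) - x) (- alpha)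
                             * theta dt k i k j x)
                          (node dt j) (node dt (S j))) (2 * k + 1).
Proof. unfold omega. apply coef_far; try assumption; try lia; lra. Qed.

Let bnd_far (l : nat) :
  bnd (l + (2 * k + 1)) = Rpower (node dt (2 * k + 2 + l + k)) (- alpha).
Proof. unfold bnd. do 2 f_equal. lia. Qed.

(** By mean zero only the oscillation of the kernel counts; the kernel being monotone, this is a
    difference of end values, ready for telescoping. *)
Lemma omega_bound : exists A, 0 <= A /\ forall l,
  Rabs (omega dt alpha k i (2 * k + 2 + l)) <= A * (bnd l - bnd (l + (2 * k + 1))).
Proof.
  destruct (theta_osc dt k i k Hdt Hi Hk) as [M [M0 HM]].
  exists (Rabs (Rpower dt alpha * / Gamma (1 - alpha)) * M).
  split; [apply Rmult_le_pos; [apply Rabs_pos | exact M0]|]. intros l.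
  rewrite omega_far, Rabs_mult, Rmult_assoc. apply Rmult_le_compat_l; [apply Rabs_pos|].
  assert (B := HM (fun x => Rpower (node dt (2 * k + 2 + l + k) - x) (- alpha))
                 (bnd (l + (2 * k + 1))) (bnd l - bnd (l + (2 * k + 1)))).
  rewrite RInt_theta_total, Rmult_0_r, Rminus_0_r in B by assumption.
  rewrite Rmult_comm. apply B; intros x Hx; pose proof (far l); pose proof (node_pos l).
  - apply kernel_continuous. lra.
  - rewrite bnd_far.
    assert (Rpower (node dt (2 * k + 2 + l + k)) (- alpha)
            <= Rpower (node dt (2 * k + 2 + l + k) - x) (- alpha)) by (apply Rpower_neg_decr; lra).
    assert (Rpower (node dt (2 * k + 2 + l + k) - x) (- alpha) <= bnd l)
      by (apply Rpower_neg_decr; lra).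
    rewrite Rabs_pos_eq; lra.
Qed.

(** The same argument with the kernel replaced by its difference over one step, which is monotone by
    convexity. *)
Lemma omega_diff_bound : exists A, 0 <= A /\ forall l,
  Rabs (omega dt alpha k i (2 * k + 2 + l) - omega dt alpha k i (2 * k + 2 + S l))
  <= A * ((bnd l - bnd (S l)) - (bnd (l + (2 * k + 1)) - bnd (S (l + (2 * k + 1))))).
Proof.
  destruct (theta_osc dt k i k Hdt Hi Hk) as [M [M0 HM]].
  exists (Rabs (Rpower dt alpha * / Gamma (1 - alpha)) * M).
  split; [apply Rmult_le_pos; [apply Rabs_pos | exact M0]|]. intros l.
  set (T := node dt (2 * k + 2 + l + k)).
  assert (ET : node dt (2 * k + 2 + S l + k) = T + dt).
  { unfold T. rewrite <- node_S. f_equal. lia. }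
  pose proof (far l) as F. pose proof (node_pos l) as NP. fold T in F.
  set (L := node dt (2 * k + 1)) in *.
  assert (E : omega dt alpha k i (2 * k + 2 + l) - omega dt alpha k i (2 * k + 2 + S l)
    = Rpower dt alpha * / Gamma (1 - alpha)
      * rsum (fun j => RInt (fun x => (Rpower (T - x) (- alpha) - Rpower (T + dt - x) (- alpha))
                             * theta dt k i k j x)
                          (node dt j) (node dt (S j))) (2 * k + 1)).
  { rewrite !omega_far, ET. fold T. rewrite <- Rmult_minus_distr_l. f_equal.
    match goal with |- ?a - ?b = _ => replace (a - b) with (a + -1 * b) by ring end.
    rewrite <- rsum_scal, <- rsum_plus. apply rsum_ext. intros j Hj.
    pose proof (node_lt dt j (S j) Hdt ltac:(lia)) as L1.
    pose proof (node_le dt (S j) (2 * k + 1) Hdt ltac:(lia)) as L2. fold L in L2.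
    assert (Ch : forall x, continuous (theta dt k i k j) x)
      by (intros; apply theta_continuous; assumption).
    pose proof (ex_RInt_kernel T alpha (node dt j) (node dt (S j)) _ ltac:(lra) ltac:(lra) Ch) as X1.
    pose proof (ex_RInt_kernel (T + dt) alpha (node dt j) (node dt (S j)) _
                  ltac:(lra) ltac:(lra) Ch) as X2.
    pose proof (RInt_minus (V := R_CompleteNormedModule) _ _ _ _ X1 X2) as X3.
    symmetry. etransitivity; [|etransitivity; [exact X3|]].
    - apply RInt_ext. intros x _.
      change ((Rpower (T - x) (- alpha) - Rpower (T + dt - x) (- alpha)) * theta dt k i k j x
        = Rpower (T - x) (- alpha) * theta dt k i k j x
          - Rpower (T + dt - x) (- alpha) * theta dt k i k j x). ring.
    - match goal with |- minus ?a ?b = ?a + -1 * ?b => change (a - b = a + -1 * b :> R) end.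
      ring. }
  rewrite E, Rabs_mult, Rmult_assoc. apply Rmult_le_compat_l; [apply Rabs_pos|].
  assert (B := HM (fun x => Rpower (T - x) (- alpha) - Rpower (T + dt - x) (- alpha))
                 (bnd (l + (2 * k + 1)) - bnd (S (l + (2 * k + 1))))
                 (bnd l - bnd (S l) - (bnd (l + (2 * k + 1)) - bnd (S (l + (2 * k + 1)))))).
  rewrite RInt_theta_total, Rmult_0_r, Rminus_0_r in B by assumption.
  rewrite Rmult_comm. fold L in B.
  assert (Efar : bnd (l + (2 * k + 1)) = Rpower T (- alpha)) by apply bnd_far.
  assert (Efar' : bnd (S (l + (2 * k + 1))) = Rpower (T + dt) (- alpha)).
  { change (S (l + (2 * k + 1))) with (S l + (2 * k + 1))%nat. rewrite bnd_far, ET. reflexivity. }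
  assert (En : bnd l = Rpower (T - L) (- alpha)) by (unfold bnd; rewrite F; reflexivity).
  assert (En' : bnd (S l) = Rpower (T - L + dt) (- alpha)).
  { unfold bnd. rewrite F, <- node_S. do 2 f_equal. lia. }
  apply B; intros x Hx.
  - apply (continuous_minus (V := R_NormedModule)); apply kernel_continuous; lra.
  - rewrite Efar, Efar', En, En'.
    pose proof (Rpower_neg_diff_decr alpha dt (T - x) T ltac:(lra) Hdt ltac:(lra) ltac:(lra)) as H1.
    pose proof (Rpower_neg_diff_decr alpha dt (T - L) (T - x) ltac:(lra) Hdt ltac:(lra) ltac:(lra)) as H2.
    replace (T - x + dt) with (T + dt - x) in * by ring.
    rewrite Rabs_pos_eq; lra.
Qed.

Lemma omega_summable : exists S, forall N,
  rsum (fun l => Rabs (omega dt alpha k i (2 * k + 2 + l))) N <= S.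
Proof.
  destruct omega_bound as [A [A0 HA]]. exists (A * (INR (2 * k + 1) * bnd O)). intros N.
  eapply Rle_trans; [apply rsum_le; intros l _; apply HA|]. rewrite rsum_scal.
  apply Rmult_le_compat_l; [exact A0|]. apply rsum_telescope_le; assumption.
Qed.

(** Telescoping happens twice: over [l] it bounds the variation beyond [j] by a multiple of
    [bnd j - bnd (S j)], and these bounds telescope again over [j]. *)
Lemma omega_variation : exists (beta : nat -> R) (S : R),
  (forall j N, rsum (fun l => Rabs (omega dt alpha k i (2 * k + 2 + j + l)
                                   - omega dt alpha k i (2 * k + 2 + j + l + 1))) N <= beta j) /\
  (forall N, rsum beta N <= S).
Proof.
  destruct omega_diff_bound as [A [A0 HA]].
  set (G := fun l => bnd l - bnd (S l)).
  assert (G0 : forall l, 0 <= G l) by (intros l; pose proof (bnd_decr l); unfold G; lra).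
  exists (fun j => A * (INR (2 * k + 1) * G j)), (A * (INR (2 * k + 1) * bnd O)). split.
  - intros j N.
    eapply Rle_trans; [apply (rsum_le _ (fun l => A * (G (j + l)%nat - G (j + (l + (2 * k + 1)))%nat)))|].
    + intros l _. specialize (HA (j + l)%nat). unfold G.
      replace (2 * k + 2 + (j + l))%nat with (2 * k + 2 + j + l)%nat in HA by lia.
      replace (2 * k + 2 + S (j + l))%nat with (2 * k + 2 + j + l + 1)%nat in HA by lia.
      replace (j + (l + (2 * k + 1)))%nat with (j + l + (2 * k + 1))%nat by lia. exact HA.
    + rewrite rsum_scal. apply Rmult_le_compat_l; [exact A0|].
      replace (G j) with (G (j + 0)%nat) by (f_equal; lia).
      apply (rsum_telescope_le (fun l => G (j + l)%nat)).
      * intros; apply G0.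
      * intros l. rewrite Nat.add_succ_r. unfold G. apply bnd_conv.
  - intros N. rewrite rsum_scal, rsum_scal. apply Rmult_le_compat_l; [exact A0|].
    apply Rmult_le_compat_l; [apply pos_INR|].
    pose proof (rsum_telescope_le bnd 1 N bnd_pos bnd_decr) as H. simpl INR in H.
    rewrite Rmult_1_l in H. eapply Rle_trans; [|exact H]. right. apply rsum_ext.
    intros l _. unfold G. do 2 f_equal. lia.
Qed.

End Decay.

(** * Stability of the recursion *)

Definition cw (dt alpha : R) (k i : nat) : nat -> C := fun m => RtoC (omega dt alpha k i m).

Lemma sum_f_R0_rsum (f : nat -> R) (n : nat) : sum_f_R0 f n = rsum f (S n).
Proof. induction n as [|n IH]; simpl in *; [ring | rewrite IH; reflexivity]. Qed.

Lemma l1b_of_tail (a : nat -> C) (N : nat) (S : R) :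
  (forall n, rsum (fun l => Cmod (a (N + l)%nat)) n <= S) -> l1b a (asum a N + S).
Proof.
  intros H n. eapply Rle_trans; [apply (asum_split_le a N n)|].
  apply Rplus_le_compat_l. unfold asum. rewrite sum_f_R0_rsum. apply H.
Qed.

Lemma cw_l1b (dt alpha : R) (k i : nat) :
  0 < alpha < 1 -> 0 < dt -> (1 <= i)%nat -> (i <= k)%nat ->
  exists A, l1b (cw dt alpha k i) A.
Proof.
  intros Ha Hdt Hi Hk. destruct (omega_summable dt alpha k i Hdt Ha Hi Hk) as [S HS].
  eexists. apply (l1b_of_tail _ (2 * k + 2) S). intros n.
  eapply Rle_trans; [|apply (HS n)]. right. apply rsum_ext. intros l _. apply Cmod_R.
Qed.

(** Summation by parts: [1 - x] times the sum leaves two boundary terms and the increments of [a],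
    each multiplied by a power of [x] of modulus at most 1. *)
Lemma abel_partial (a : nat -> C) (x : C) (n p : nat) :
  Cmod x <= 1 ->
  Cmod ((1 - x) * conv (fun m => a (n + m)%nat * x ^ (n + m))%C ones p)%C
  <= Cmod (a n) + Cmod (a (n + p)%nat)
     + rsum (fun l => Cmod (a (n + l)%nat - a (n + l + 1)%nat)%C) p.
Proof.
  intros Hx.
  assert (X : forall q, Cmod (x ^ q)%C <= 1).
  { intros q. rewrite Cmod_pow, <- (pow1 q). apply pow_incr. split; [apply Cmod_ge_0 | exact Hx]. }
  assert (E : exists r, Cmod r <= rsum (fun l => Cmod (a (n + l)%nat - a (n + l + 1)%nat)%C) p /\
     ((1 - x) * conv (fun m => a (n + m)%nat * x ^ (n + m)) ones p
      = a n * x ^ n + - (a (n + p)%nat * x ^ (n + p + 1)) + r)%C).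
  { induction p as [|p [r [Hr IH]]].
    - exists (RtoC 0). split; [rewrite Cmod_0; simpl; lra|].
      simpl conv. unfold ones. rewrite Nat.add_0_r, (Cpow_add_r x n 1), Cpow_1_r. ring.
    - exists (r + (a (n + p + 1)%nat - a (n + p)%nat) * x ^ (n + p + 1))%C. split.
      + simpl rsum. eapply Rle_trans; [apply Cmod_triangle|]. apply Rplus_le_compat; [exact Hr|].
        rewrite Cmod_mult.
        replace (a (n + p + 1)%nat - a (n + p)%nat)%C
          with (- (a (n + p)%nat - a (n + p + 1)%nat))%C by ring.
        rewrite Cmod_opp. pose proof (Cmod_ge_0 (a (n + p)%nat - a (n + p + 1)%nat)%C).
        pose proof (X (n + p + 1)%nat). pose proof (Cmod_ge_0 (x ^ (n + p + 1))%C). nra.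
      + rewrite conv_ones_r, sum_Sn, <- conv_ones_r. change (@plus C_AbelianMonoid) with Cplus.
        replace (n + S p)%nat with (n + p + 1)%nat by lia.
        rewrite (Cpow_add_r x (n + p + 1) 1), Cpow_1_r.
        rewrite Cmult_plus_distr_l, IH. ring. }
  destruct E as [r [Hr ->]].
  eapply Rle_trans; [apply Cmod_triangle|]. apply Rplus_le_compat; [|exact Hr].
  eapply Rle_trans; [apply Cmod_triangle|].
  rewrite Cmod_opp, !Cmod_mult.
  pose proof (X n). pose proof (X (n + p + 1)%nat).
  pose proof (Cmod_ge_0 (a n)). pose proof (Cmod_ge_0 (a (n + p)%nat)). nra.
Qed.

Lemma variation_bound (a : nat -> C) (n p : nat) :
  Cmod (a (n + p)%nat)
  <= Cmod (a n) + rsum (fun l => Cmod (a (n + l)%nat - a (n + l + 1)%nat)%C) p.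
Proof.
  induction p as [|p IH]; simpl.
  - rewrite Nat.add_0_r. lra.
  - replace (n + S p)%nat with (n + p + 1)%nat by lia.
    replace (a (n + p + 1)%nat) with (a (n + p)%nat + - (a (n + p)%nat - a (n + p + 1)%nat))%C at 1 by ring.
    eapply Rle_trans; [apply Cmod_triangle|]. rewrite Cmod_opp. lra.
Qed.

(* Minus the [n]-th partial sum of [a m * x ^ m - z delta] is a tail, and summation by parts bounds
   [1 - x] times that tail by the variation of [a] beyond [n]. *)
Lemma partial_sums_l1b (a : nat -> C) (A V : R) (N : nat) (beta : nat -> R) (x z : C) :
  l1b a A -> Cmod x <= 1 -> x <> RtoC 1 ->
  (forall j n, rsum (fun l => Cmod (a (N + j + l)%nat - a (N + j + l + 1)%nat)%C) n <= beta j) ->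
  (forall n, rsum beta n <= V) ->
  sums (wt x a) z -> exists K, l1b (ssub (conv (wt x a) ones) (fun _ => z)) K.
Proof.
  intros Ha Hx Hx1 Hb HV Hz.
  set (d := Cmod (1 - x)%C).
  assert (D : 0 < d).
  { apply Cmod_gt_0. intros E. apply Hx1. replace x with (1 - (1 - x))%C by ring. rewrite E. ring. }
  assert (B0 : forall j, 0 <= beta j) by (intros j; apply (Hb j O)).
  (* The tail starts at [N + S j]. By [variation_bound] the far boundary term is at most the near
     one plus the variation, whence the factor 2. *)
  assert (T : forall j, Cmod (conv (wt x a) ones (N + j)%nat - z)%C
              <= 2 / d * (Cmod (a (N + S j)%nat) + beta (S j))).
  { intros j. set (n := (N + S j)%nat).
    assert (H : Cmod (- ((1 - x) * (conv (wt x a) ones (N + j)%nat - z)))%C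
                <= 2 * (Cmod (a n) + beta (S j))).
    { apply (limC_Cmod_le (fun p => (1 - x) * (conv (wt x a) ones p - conv (wt x a) ones (N + j)%nat))%C
               _ _ n).
      - intros eps Heps. destruct (Hz (eps / d)) as [M HM]; [apply Rdiv_lt_0_compat; lra|].
        exists M. intros p Hp.
        replace ((1 - x) * (conv (wt x a) ones p - conv (wt x a) ones (N + j)%nat)
                 - - ((1 - x) * (conv (wt x a) ones (N + j)%nat - z)))%C
          with ((1 - x) * (conv (wt x a) ones p - z))%C by ring.
        rewrite Cmod_mult. fold d. specialize (HM p Hp). apply Rlt_div_r in HM; [lra | exact D].
      - intros p Hp. replace p with (S (N + j) + (p - n))%nat by (unfold n in *; lia).
        rewrite conv_ones_shift.
        replace (conv (wt x a) ones (N + j)%nat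
                 + conv (fun m => wt x a (S (N + j) + m)%nat) ones (p - n)
                 - conv (wt x a) ones (N + j)%nat)%C
          with (conv (fun m => wt x a (S (N + j) + m)%nat) ones (p - n)) by ring.
        replace (S (N + j)) with n by (unfold n; lia).
        eapply Rle_trans; [apply (abel_partial a x n (p - n) Hx)|].
        pose proof (variation_bound a n (p - n)) as H1.
        pose proof (Hb (S j) (p - n)%nat) as H2. fold n in H2. lra. }
    rewrite Cmod_opp, Cmod_mult in H. fold d in H.
    apply Rmult_le_reg_l with d; [exact D|].
    replace (d * (2 / d * (Cmod (a n) + beta (S j)))) with (2 * (Cmod (a n) + beta (S j)))
      by (field; lra). exact H. }
  eexists. apply (l1b_of_tail _ N (2 / d * (A + V))). intros n.
  assert (D2 : 0 < 2 / d) by (apply Rdiv_lt_0_compat; lra).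
  eapply Rle_trans; [apply rsum_le; intros j _; apply T|].
  rewrite rsum_scal. apply Rmult_le_compat_l; [lra|]. rewrite rsum_plus.
  apply Rplus_le_compat.
  - destruct n as [|n]; [simpl; apply (l1b_pos a A Ha)|].
    rewrite <- sum_f_R0_rsum.
    eapply Rle_trans; [|apply (Ha (S N + n)%nat)].
    eapply Rle_trans; [|apply (asum_shift_le a (S N) n)]. unfold asum.
    right. apply sum_eq. intros m _. do 2 f_equal. lia.
  - eapply Rle_trans; [|apply (HV (S n))]. rewrite rsum_S_l. pose proof (B0 O). lra.
Qed.

Lemma sum_n_RtoC (f : nat -> R) (n : nat) : sum_n (fun j => RtoC (f j)) n = RtoC (rsum f (S n)).
Proof.
  induction n as [|n IH].
  - rewrite sum_O. simpl. rewrite Rplus_0_l. reflexivity.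
  - rewrite sum_Sn, IH. symmetry. apply RtoC_plus.
Qed.

Lemma conv_cw_sum_n (dt alpha : R) (k i : nat) (u : nat -> C) (n : nat) :
  sum_n (fun j => RtoC (omega dt alpha k i (n - j)) * u j)%C n = conv (cw dt alpha k i) u n.
Proof.
  rewrite conv_comm, conv_sum_n. apply sum_n_ext. intros j. apply Cmult_comm.
Qed.

(** The constant sequence satisfies the recursion with [z = 0]: [wcoef] corrects [omega] to [coef]
    for [j < k], and the two agree from [k] on, so the total is [coef_sum_zero]. *)
Lemma constant_identity (dt alpha : R) (k i n : nat) :
  0 < alpha < 1 -> 0 < dt -> (1 <= i)%nat -> (i <= k)%nat -> (k <= 6)%nat -> (k <= n)%nat ->
  (RtoC (rsum (wcoef dt alpha k i n) k) + conv (cw dt alpha k i) ones n)%C = RtoC 0.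
Proof.
  intros Ha Hdt Hi Hk H6 Hn. rewrite <- conv_cw_sum_n.
  rewrite (sum_n_ext _ (fun j => RtoC (omega dt alpha k i (n - j))))
    by (intros; apply Cmult_1_r).
  rewrite sum_n_RtoC, <- RtoC_plus. f_equal.
  rewrite <- (coef_sum_zero dt alpha k i n) by (try assumption; lra).
  set (g := fun j => if (j <? k)%nat then wcoef dt alpha k i n j else 0).
  replace (rsum (wcoef dt alpha k i n) k) with (rsum g (S n)).
  - rewrite <- rsum_plus. apply rsum_ext. intros j Hj. unfold g.
    destruct (Nat.ltb_spec j k); [unfold wcoef; ring|].
    rewrite coef_omega by (try assumption; try lia; lra). ring.
  - rewrite (rsum_trunc g k (S n)); [|lia|].
    + apply rsum_ext. intros j Hj. unfold g. apply Nat.ltb_lt in Hj. rewrite Hj. reflexivity.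
    + intros j Hj. unfold g. destruct (Nat.ltb_spec j k); [lia|reflexivity].
Qed.

Lemma wcoef_limit (dt alpha : R) (k i j : nat) (eps : R) :
  0 < alpha < 1 -> 0 < dt -> (1 <= i)%nat -> (i <= k)%nat -> (j < k)%nat -> 0 < eps ->
  exists N, forall n, (N <= n)%nat -> Rabs (wcoef dt alpha k i n j) < eps.
Proof.
  intros Ha Hdt Hi Hk Hj Heps.
  destruct (coef_limit dt alpha k i Hdt Ha Hi Hk j (eps / 2)) as [N HN]; [lia|lra|].
  destruct (coef_limit dt alpha k i Hdt Ha Hi Hk k (eps / 2)) as [M HM]; [lia|lra|].
  exists (N + M + k)%nat. intros n Hn. unfold wcoef, omega.
  pose proof (HN n ltac:(lia)). pose proof (HM (n - j + k)%nat ltac:(lia)).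
  eapply Rle_lt_trans; [apply Rabs_triang|]. rewrite Rabs_Ropp. lra.
Qed.

Lemma limC_0_finite_sum (w : nat -> nat -> C) (p : nat) :
  (forall j, (j <= p)%nat -> limC (fun n => w n j) 0) -> limC (fun n => sum_n (w n) p) 0.
Proof.
  intros H. induction p as [|p IH].
  - intros eps Heps. destruct (H O (Nat.le_refl _) eps Heps) as [N HN]. exists N.
    intros n Hn. rewrite sum_O. auto.
  - intros eps Heps. destruct (IH (fun j Hj => H j ltac:(lia)) (eps / 2)) as [N HN]; [lra|].
    destruct (H (S p) (Nat.le_refl _) (eps / 2)) as [M HM]; [lra|].
    exists (N + M)%nat. intros n Hn. rewrite sum_Sn. change (@plus C_AbelianMonoid) with Cplus.
    replace (sum_n (w n) p + w n (S p) - 0)%C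
      with ((sum_n (w n) p - 0) + (w n (S p) - 0))%C by ring.
    eapply Rle_lt_trans; [apply Cmod_triangle|].
    pose proof (HN n ltac:(lia)). pose proof (HM n ltac:(lia)). lra.
Qed.

Lemma start_terms_limit (dt alpha : R) (k i : nat) (s : nat -> C) :
  0 < alpha < 1 -> 0 < dt -> (1 <= i)%nat -> (i <= k)%nat ->
  limC (fun n => sum_n (fun j => RtoC (wcoef dt alpha k i n j) * s j)%C (k - 1)) 0.
Proof.
  intros Ha Hdt Hi Hk. apply limC_0_finite_sum. intros j Hj eps Heps.
  pose proof (Cmod_ge_0 (s j)) as S0.
  destruct (wcoef_limit dt alpha k i j (eps / (Cmod (s j) + 1))) as [N HN];
    try assumption; [lia|apply Rdiv_lt_0_compat; lra|].
  exists N. intros n Hn. specialize (HN n Hn).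
  replace (RtoC (wcoef dt alpha k i n j) * s j - 0)%C with (RtoC (wcoef dt alpha k i n j) * s j)%C by ring.
  rewrite Cmod_mult, Cmod_R. apply Rlt_div_r in HN; [|lra].
  pose proof (Rabs_pos (wcoef dt alpha k i n j)). nra.
Qed.

Definition symb (dt alpha : R) (k i : nat) (z : C) : nat -> C :=
  fun n => (cw dt alpha k i n - z * sone n)%C.

Lemma conv_symb (dt alpha : R) (k i : nat) (z : C) (u : nat -> C) (n : nat) :
  conv (symb dt alpha k i z) u n = (conv (cw dt alpha k i) u n - z * u n)%C.
Proof.
  replace (symb dt alpha k i z) with (fun m => (- z) * sone m + cw dt alpha k i m)%C
    by (apply functional_extensionality; intros; unfold symb; ring).
  rewrite conv_axpy_l, conv_one_l. ring.
Qed.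

Lemma wt_symb (dt alpha : R) (k i : nat) (z x : C) :
  wt x (symb dt alpha k i z) = ssub (wt x (cw dt alpha k i)) (fun n => z * sone n)%C.
Proof.
  apply functional_extensionality. intros n. unfold wt, symb, ssub.
  destruct n as [|n]; simpl; ring.
Qed.

Lemma sums_delta (z : C) : sums (fun n => z * sone n)%C z.
Proof.
  intros eps Heps. exists O. intros n _. rewrite conv_scal_l, conv_one_l. unfold ones.
  replace (z * 1 - z)%C with (RtoC 0) by ring. rewrite Cmod_0. exact Heps.
Qed.

Lemma symb_l1b (dt alpha : R) (k i : nat) (z : C) (A : R) :
  l1b (cw dt alpha k i) A -> exists B, l1b (symb dt alpha k i z) B.
Proof.
  intros HA. exists (A + Cmod z * 1). intros n.
  replace (symb dt alpha k i z) with (sadd (cw dt alpha k i) (fun m => - z * sone m)%C)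
    by (apply functional_extensionality; intros; unfold symb, sadd; ring).
  eapply Rle_trans; [apply asum_add|]. apply Rplus_le_compat; [apply HA|].
  unfold asum. rewrite (sum_eq _ (fun m => Cmod (sone m) * Cmod z)).
  - rewrite <- scal_sum. apply Rmult_le_compat_l; [apply Cmod_ge_0 | apply l1b_one].
  - intros m _. rewrite Cmod_mult, Cmod_opp. ring.
Qed.

Lemma stable_outside_range (dt alpha : R) (k i : nat) (z : C) :
  0 < alpha < 1 -> 0 < dt -> (1 <= i)%nat -> (i <= k)%nat ->
  (forall x, Cmod x <= 1 -> ~ sums (wt x (cw dt alpha k i)) z) ->
  stab_region dt alpha k i z.
Proof.
  intros Ha Hdt Hi Hk Hz. destruct (cw_l1b dt alpha k i Ha Hdt Hi Hk) as [A HA].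
  set (f := symb dt alpha k i z). destruct (symb_l1b dt alpha k i z A HA) as [B HB].
  assert (Hf : forall x, Cmod x <= 1 -> ~ sums (wt x f) 0).
  { intros x Hx H. destruct (l1b_sums _ _ (l1b_wt x _ A Hx HA)) as [l Hl].
    pose proof (sums_sub _ _ _ _ Hl (sums_delta z)) as H1. rewrite <- wt_symb in H1.
    pose proof (limC_unique _ _ _ H1 H) as E. apply (Hz x Hx).
    replace z with l; [exact Hl|]. replace l with (l - z + z)%C by ring. rewrite E. ring. }
  (* [f 0] is the value of the symbol at [x = 0] and also the coefficient by which the recursion is
     solved for [u n]. *)
  assert (f0 : f O <> RtoC 0).
  { intros E. apply (Hf 0); [rewrite Cmod_0; lra|].
    replace (wt 0 f) with (fun n => 0 * sone n)%C; [apply sums_delta|].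
    apply functional_extensionality. intros [|n]; unfold wt; simpl; [rewrite E; ring|ring]. }
  set (c := sinv f). assert (Ec : conv c f = sone) by (apply sinv_l, f0).
  destruct (wiener f c B HB Hf Ec) as [K HK].
  intros s.
  (* The first [k] entries are those of [f] convolved with the starting values, so starting values
     and recursion together are the single equation [f * u = g]. Altering finitely many entries does
     not affect the limit. *)
  set (g := fun n => if (n <? k)%nat then conv f s n
    else (- sum_n (fun j => RtoC (wcoef dt alpha k i n j) * s j) (k - 1))%C).
  assert (Starts : forall u n, starts k u s ->
    sum_n (fun j => RtoC (wcoef dt alpha k i n j) * u j)%C (k - 1)
    = sum_n (fun j => RtoC (wcoef dt alpha k i n j) * s j)%C (k - 1)).
  { intros u n Hu. apply sum_n_ext_loc. intros j Hj. rewrite Hu by lia. reflexivity. }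
  assert (Char : forall u, starts k u s -> recursion dt alpha k i z u -> u = conv c g).
  { intros u Hu Hr. replace g with (conv f u).
    - transitivity (conv (conv c f) u); [rewrite Ec; ring | ring].
    - apply functional_extensionality. intros n. unfold g.
      destruct (Nat.ltb_spec n k) as [h|h].
      + apply conv_ext_le. intros m Hm. apply Hu. lia.
      + specialize (Hr n h). rewrite conv_cw_sum_n, Starts in Hr by exact Hu.
        unfold f. rewrite conv_symb, <- Hr. ring. }
  assert (Hg : limC g 0).
  { intros eps Heps.
    destruct (start_terms_limit dt alpha k i s Ha Hdt Hi Hk eps Heps) as [N HN].
    exists (N + k)%nat. intros n Hn. unfold g.
    destruct (Nat.ltb_spec n k); [lia|]. specialize (HN n ltac:(lia)).
    set (t := sum_n _ _) in HN |- *. replace (- t - 0)%C with (- (t - 0))%C by ring.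
    rewrite Cmod_opp. exact HN. }
  split; [|split].
  - exists (conv c g).
    assert (Hs : starts k (conv c g) s).
    { intros n Hn. rewrite (conv_ext_le c g (conv f s)).
      - rewrite conv_assoc, Ec, conv_one_l. reflexivity.
      - intros m Hm. unfold g. destruct (Nat.ltb_spec m k); [reflexivity|lia]. }
    split; [exact Hs|]. intros n Hn. rewrite conv_cw_sum_n, Starts by exact Hs.
    assert (E : conv f (conv c g) n = g n).
    { rewrite conv_assoc, (conv_comm f c), Ec, conv_one_l. reflexivity. }
    unfold f in E. rewrite conv_symb in E. unfold g at 3 in E.
    destruct (Nat.ltb_spec n k); [lia|].
    match type of E with (?p - ?q = - ?r)%C => replace p with (p - q + q)%C by ring end.
    rewrite E. ring.
  - intros u v Hu Hv Ru Rv n. rewrite (Char u Hu Ru), (Char v Hv Rv). reflexivity.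
  - intros u Hu Hr. rewrite (Char u Hu Hr). pose proof (conv_lim_0 c g K HK Hg) as L.
    apply is_lim_seq_spec. intros eps. destruct (L eps (cond_pos eps)) as [N HN].
    exists N. intros n Hn. specialize (HN n Hn).
    replace (conv c g n - 0)%C with (conv c g n) in HN by ring.
    rewrite Rminus_0_r, Rabs_pos_eq by apply Cmod_ge_0. exact HN.
Qed.

(** * Instability on the range of the symbol *)

Lemma sum_n_wcoef_ones (dt alpha : R) (k i n : nat) : (1 <= k)%nat ->
  sum_n (fun j => RtoC (wcoef dt alpha k i n j) * 1)%C (k - 1)
  = RtoC (rsum (wcoef dt alpha k i n) k).
Proof.
  intros Hk. rewrite (sum_n_ext _ (fun j => RtoC (wcoef dt alpha k i n j)))
    by (intros; apply Cmult_1_r).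
  rewrite sum_n_RtoC. do 2 f_equal. lia.
Qed.

Lemma zero_unstable (dt alpha : R) (k i : nat) :
  0 < alpha < 1 -> 0 < dt -> (1 <= i)%nat -> (i <= k)%nat -> (k <= 6)%nat ->
  ~ stab_region dt alpha k i 0.
Proof.
  intros Ha Hdt Hi Hk H6 Hs. destruct (Hs ones) as [_ [_ L]].
  assert (H : is_lim_seq (fun n => Cmod (ones n)) 0).
  { apply L; [intros j _; reflexivity|]. intros n Hn. rewrite conv_cw_sum_n.
    unfold ones at 1. rewrite sum_n_wcoef_ones by lia.
    rewrite constant_identity by assumption. ring. }
  assert (H1 : is_lim_seq (fun n => Cmod (ones n)) 1).
  { apply (is_lim_seq_ext (fun _ => 1)); [intros; unfold ones; rewrite Cmod_1; reflexivity|].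
    apply is_lim_seq_const. }
  apply is_lim_seq_unique in H. apply is_lim_seq_unique in H1. rewrite H in H1.
  injection H1. lra.
Qed.

(** By [constant_identity] the partial sums of [omega] are minus the sums of the starting weights,
    which tend to zero. *)
Lemma symbol_at_one (dt alpha : R) (k i : nat) (z : C) :
  0 < alpha < 1 -> 0 < dt -> (1 <= i)%nat -> (i <= k)%nat -> (k <= 6)%nat ->
  sums (wt 1 (cw dt alpha k i)) z -> z = RtoC 0.
Proof.
  intros Ha Hdt Hi Hk H6 Hz.
  replace (wt 1 (cw dt alpha k i)) with (cw dt alpha k i) in Hz
    by (apply functional_extensionality; intros; unfold wt; rewrite Cpow_1_l; ring).
  apply (limC_unique _ _ _ Hz). intros eps Heps.
  destruct (start_terms_limit dt alpha k i ones Ha Hdt Hi Hk eps Heps) as [N HN].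
  exists (N + k)%nat. intros n Hn. specialize (HN n ltac:(lia)).
  unfold ones at 1 in HN. rewrite sum_n_wcoef_ones in HN by lia.
  pose proof (constant_identity dt alpha k i n Ha Hdt Hi Hk H6 ltac:(lia)) as E.
  set (r := RtoC (rsum (wcoef dt alpha k i n) k)) in *.
  replace (conv (cw dt alpha k i) ones n - 0)%C with (- (r - 0))%C.
  - rewrite Cmod_opp. exact HN.
  - replace (conv (cw dt alpha k i) ones n) with (r + conv (cw dt alpha k i) ones n - r)%C by ring.
    rewrite E. ring.
Qed.

(* At [xi = 0] the recursion at [n = k] does not involve [u k]: it is a constraint on the starting
   values, which constant ones can satisfy only if [omega 0 = 0]. *)
Lemma symbol_at_zero (dt alpha : R) (k i : nat) (z : C) :
  0 < alpha < 1 -> 0 < dt -> (1 <= i)%nat -> (i <= k)%nat -> (k <= 6)%nat ->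
  z = cw dt alpha k i 0 -> stab_region dt alpha k i z -> z = RtoC 0.
Proof.
  intros Ha Hdt Hi Hk H6 Ez Hs.
  destruct (Hs ones) as [[u [Hu Hr]] _].
  specialize (Hr k (Nat.le_refl _)). rewrite conv_cw_sum_n in Hr.
  rewrite (sum_n_ext_loc _ (fun j => RtoC (wcoef dt alpha k i k j) * 1)%C) in Hr
    by (intros j Hj; rewrite Hu by lia; reflexivity).
  rewrite sum_n_wcoef_ones in Hr by lia.
  pose proof (constant_identity dt alpha k i k Ha Hdt Hi Hk H6 (Nat.le_refl _)) as E.
  destruct k as [|p]; [lia|]. simpl conv in Hr, E.
  rewrite (conv_ext_le (tl (cw dt alpha (S p) i)) u ones) in Hr
    by (intros m Hm; apply Hu; lia).
  rewrite <- Ez in Hr, E. unfold ones at 1 in E.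
  set (t := conv (tl (cw dt alpha (S p) i)) ones p) in *.
  set (r := RtoC (rsum (wcoef dt alpha (S p) i (S p)) (S p))) in *.
  assert (E1 : (r + t)%C = RtoC 0).
  { replace (r + t)%C with (r + (z * u (S p) + t) - z * u (S p))%C by ring.
    rewrite Hr. ring. }
  replace z with (r + (z * 1 + t) - (r + t))%C by ring. rewrite E, E1. ring.
Qed.

Definition shift_one (k : nat) : nat -> C := fun n => if (n =? k)%nat then RtoC 1 else RtoC 0.

Lemma sums_shift_one (z x : C) (k : nat) :
  sums (wt x (fun n => z * shift_one k n)%C) (z * x ^ k)%C.
Proof.
  intros eps Heps. exists k. intros n Hn. rewrite conv_ones_r, (sum_n_single _ k n Hn).
  - unfold wt, shift_one. rewrite Nat.eqb_refl.
    replace (z * 1 * x ^ k - z * x ^ k)%C with (RtoC 0) by ring. rewrite Cmod_0. exact Heps.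
  - intros j _ Hj. unfold wt, shift_one. apply Nat.eqb_neq in Hj. rewrite Hj. ring.
Qed.

(** The polynomial [1 - X], inverse to [ones]. *)
Definition sdiff : nat -> C := fun n => match n with O => RtoC 1 | S O => RtoC (-1) | _ => RtoC 0 end.

Lemma sdiff_S (u : nat -> C) (n : nat) : conv sdiff u (S n) = (u (S n) - u n)%C.
Proof.
  simpl. replace (tl sdiff) with (fun m => RtoC (-1) * sone m)%C.
  - rewrite conv_scal_l, conv_one_l. ring.
  - apply functional_extensionality. intros [|[|m]]; unfold tl; simpl; ring.
Qed.

Lemma sdiff_ones : conv sdiff ones = sone.
Proof.
  apply functional_extensionality. intros [|n]; [simpl; unfold ones; ring|].
  rewrite sdiff_S. unfold ones. simpl. ring.
Qed.

Lemma unstable_in_range (dt alpha : R) (k i : nat) (z x : C) :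
  0 < alpha < 1 -> 0 < dt -> (1 <= i)%nat -> (i <= k)%nat -> (k <= 6)%nat ->
  Cmod x <= 1 -> sums (wt x (cw dt alpha k i)) z -> ~ stab_region dt alpha k i z.
Proof.
  intros Ha Hdt Hi Hk H6 Hx Hz Hs.
  assert (z0 : z <> RtoC 0).
  { intros ->. apply (zero_unstable dt alpha k i Ha Hdt Hi Hk H6 Hs). }
  assert (x1 : x <> RtoC 1).
  { intros ->. apply z0, (symbol_at_one dt alpha k i z Ha Hdt Hi Hk H6 Hz). }
  assert (x0 : x <> RtoC 0).
  { intros ->. apply z0, (symbol_at_zero dt alpha k i z Ha Hdt Hi Hk H6); [|exact Hs].
    apply (limC_unique _ _ _ Hz).
    replace (wt 0 (cw dt alpha k i)) with (fun n => cw dt alpha k i 0 * sone n)%C;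
      [apply sums_delta|].
    apply functional_extensionality. intros [|n]; unfold wt; simpl; ring. }
  destruct (cw_l1b dt alpha k i Ha Hdt Hi Hk) as [A HA].
  destruct (omega_variation dt alpha k i Hdt Ha Hi Hk) as [beta [V [Hb HV]]].
  set (f := symb dt alpha k i z).
  assert (PF : exists K, l1b (conv (wt x f) ones) K).
  { destruct (partial_sums_l1b (cw dt alpha k i) A V (2 * k + 2) beta x z) as [K HK];
      try assumption.
    - intros j n. eapply Rle_trans; [|apply (Hb j n)]. right. apply rsum_ext. intros l _.
      unfold cw. rewrite <- RtoC_minus. apply Cmod_R.
    - exists K. replace (conv (wt x f) ones) with
        (ssub (conv (wt x (cw dt alpha k i)) ones) (fun _ => z)); [exact HK|].
      unfold f. rewrite wt_symb.
      transitivity (ssub (conv (wt x (cw dt alpha k i)) ones) (conv (fun n => z * sone n)%C ones));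
        [|ring].
      f_equal. apply functional_extensionality. intros n.
      rewrite conv_scal_l, conv_one_l. unfold ones. ring. }
  destruct PF as [K HK].
  destruct (Hs ones) as [[u [Hu Hr]] [_ L]]. specialize (L u Hu Hr).
  assert (Lu : limC u 0).
  { intros eps Heps. apply is_lim_seq_spec in L. destruct (L (mkposreal eps Heps)) as [N HN].
    exists N. intros n Hn. specialize (HN n Hn). simpl in HN.
    rewrite Rminus_0_r, Rabs_pos_eq in HN by apply Cmod_ge_0.
    replace (u n - 0)%C with (u n) by ring. exact HN. }
  set (y := conv sdiff u).
  assert (Ly : limC y 0).
  { intros eps Heps. destruct (Lu (eps / 2)) as [N HN]; [lra|]. exists (S N).
    intros [|n] Hn; [lia|]. unfold y. rewrite sdiff_S.
    replace (u (S n) - u n - 0)%C with ((u (S n) - 0) + - (u n - 0))%C by ring.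
    eapply Rle_lt_trans; [apply Cmod_triangle|]. rewrite Cmod_opp.
    pose proof (HN (S n) ltac:(lia)). pose proof (HN n ltac:(lia)). lra. }
  assert (Lyx : limC (wt x y) 0).
  { intros eps Heps. destruct (Ly eps Heps) as [N HN]. exists N. intros n Hn.
    replace (wt x y n - 0)%C with (wt x y n) by ring. eapply Rle_lt_trans; [apply wt_le, Hx|].
    replace (y n) with (y n - 0)%C by ring. auto. }
  set (h := fun n => if (n <? k)%nat then RtoC 0 else RtoC 1).
  (* Below [k] both sides involve only starting values, all equal to 1. From [k] on, the recursion
     and [constant_identity] have the same starting sum, and subtraction leaves [z]. *)
  assert (E : conv f u = sadd (conv f ones) (fun n => z * h n)%C).
  { apply functional_extensionality. intros n. unfold sadd, h.
    destruct (Nat.ltb_spec n k) as [c|c].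
    - rewrite (conv_ext_le f u ones) by (intros; apply Hu; lia). ring.
    - unfold f. rewrite !conv_symb. specialize (Hr n c). rewrite conv_cw_sum_n in Hr.
      rewrite (sum_n_ext_loc _ (fun j => RtoC (wcoef dt alpha k i n j) * 1)%C) in Hr
        by (intros j Hj; rewrite Hu by lia; reflexivity).
      rewrite sum_n_wcoef_ones in Hr by lia.
      pose proof (constant_identity dt alpha k i n Ha Hdt Hi Hk H6 c) as Hc.
      set (r := RtoC (rsum (wcoef dt alpha k i n) k)) in *. unfold ones at 2.
      rewrite <- Hr.
      replace (conv (cw dt alpha k i) ones n)
        with (r + conv (cw dt alpha k i) ones n - r)%C by ring.
      rewrite Hc. ring. }
  assert (Eh : conv sdiff (fun n => z * h n)%C = (fun n => z * shift_one k n)%C).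
  { rewrite conv_comm. apply functional_extensionality. intros n. rewrite conv_scal_l. f_equal.
    rewrite conv_comm. destruct n as [|n].
    - simpl. unfold h, shift_one. destruct (Nat.ltb_spec 0 k); destruct (Nat.eqb_spec 0 k);
        try lia; ring.
    - rewrite sdiff_S. unfold h, shift_one.
      destruct (Nat.ltb_spec (S n) k); destruct (Nat.ltb_spec n k);
        destruct (Nat.eqb_spec (S n) k); try lia; ring. }
  assert (Ey : conv f y = sadd f (fun n => z * shift_one k n)%C).
  { unfold y. transitivity (conv sdiff (conv f u)); [ring|]. rewrite E, <- Eh.
    transitivity (sadd (conv f (conv sdiff ones)) (conv sdiff (fun n => z * h n)%C)); [ring|].
    rewrite sdiff_ones. ring. }
  (* Associativity moves [ones] onto [f]: the partial sums of [wt x (conv f y)] are a summable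
     sequence convolved with a null one. *)
  pose proof (conv_lim_0 _ _ _ HK Lyx) as L0.
  assert (S1 : sums (wt x (conv f y)) 0).
  { unfold sums. rewrite wt_conv.
    replace (conv (conv (wt x f) (wt x y)) ones) with (conv (conv (wt x f) ones) (wt x y)) by ring.
    exact L0. }
  assert (S2 : sums (ssub (wt x (conv f y)) (wt x (fun n => z * shift_one k n)%C))
                 (0 - z * x ^ k)%C) by (apply sums_sub; [exact S1 | apply sums_shift_one]).
  assert (S3 : sums (wt x f) (z - z)%C).
  { unfold f. rewrite wt_symb. apply sums_sub; [exact Hz | apply sums_delta]. }
  (* Two evaluations of [f] at [x]: through [Ey] it is [- z x^k], and by the choice of [z] it is
     zero. *)
  replace (ssub (wt x (conv f y)) (wt x (fun n => z * shift_one k n)%C)) with (wt x f) in S2.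
  - pose proof (limC_unique _ _ _ S2 S3) as Q.
    apply (Cmult_neq_0 z (x ^ k)%C z0 (Cpow_nz x k x0)).
    replace (z * x ^ k)%C with (- (0 - z * x ^ k))%C by ring. rewrite Q. ring.
  - rewrite Ey. apply functional_extensionality. intros n. unfold ssub, wt, sadd. ring.
Qed.

Theorem theorem3p8 (alpha dt : R) (k i : nat) :
  0 < alpha < 1 -> 0 < dt -> (1 <= i)%nat -> (i <= k)%nat -> (k <= 6)%nat ->
  (forall xi : C, Cmod xi <= 1 ->
     ex_series (fun m => Cmod (RtoC (omega dt alpha k i m) * xi ^ m)%C)) /\
  (forall z : C,
     stab_region dt alpha k i z <->
     ~ (exists xi : C, Cmod xi <= 1 /\
          is_series (fun m => (RtoC (omega dt alpha k i m) * xi ^ m)%C) z)).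
Proof.
  intros Ha Hdt Hi Hk H6. split.
  - intros xi Hxi. destruct (cw_l1b dt alpha k i Ha Hdt Hi Hk) as [A HA].
    exact (l1b_ex_series _ _ (l1b_wt xi _ A Hxi HA)).
  - intros z. split.
    + intros Hs [xi [Hxi Hz]]. apply sums_is_series in Hz.
      exact (unstable_in_range dt alpha k i z xi Ha Hdt Hi Hk H6 Hxi Hz Hs).
    + intros Hn. apply stable_outside_range; try assumption.
      intros xi Hxi Hz. apply Hn. exists xi. split; [exact Hxi|].
      apply sums_is_series. exact Hz.
Qed.
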